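(* Let $G$ be a finite group generated by pseudoreflections on $\mathbb{C}^n$, $d=|G|$, let $\Omega\subseteq\mathbb{C}^n$ be a bounded $G$-invariant domain, $\{\theta_i\}_{i=1}^n$ a homogeneous system of parameters associated to $G$, $\boldsymbol\theta=(\theta_1,\ldots,\theta_n)$, and let $\mathcal{H}\subseteq\mathcal{O}(\Omega)$ be an analytic Hilbert module over $\mathbb{C}[\boldsymbol z]$ with a $G$-invariant reproducing kernel. Then the Hilbert module $\mathcal{H}$ over $\mathbb{C}[\boldsymbol z]^G$ is unitarily equivalent to the analytic Hilbert module $\widetilde{\mathcal{H}}=\Gamma\mathcal H\subseteq\mathcal{O}(\boldsymbol\theta(\Omega))\otimes\mathbb{C}^{|G|}$ over $\mathbb{C}[\boldsymbol z]$.
   Context: A pseudoreflection on $\mathbb{C}^n$ is a linear map $\rho$ of finite order in $GL(n,\mathbb{C})$ such that $I_n-\rho$ has rank $1$. $\Omega$ is $G$-invariant if $\sigma(\Omega)=\Omega$ for all $\sigma\in G$. A homogeneous system of parameters associated to $G$ is a family $\{\theta_i\}_{i=1}^n$ of algebraically independent homogeneous $G$-invariant polynomials with $\mathbb{C}[\boldsymbol z]^G=\mathbb{C}[\theta_1,\ldots,\theta_n]$, where $\mathbb{C}[\boldsymbol z]^G$ is the ring of $G$-invariant polynomials in $\mathbb{C}[\boldsymbol z]=\mathbb{C}[z_1,\ldots,z_n]$. The set $\boldsymbol\theta(\Omega)$ is a domain. An analytic Hilbert module over $\mathbb{C}[\boldsymbol z]$ on a domain $D\subseteq\mathbb{C}^n$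 is a Hilbert space of $\mathbb{C}^m$-valued holomorphic functions on $D$ possessing an $\mathcal{L}(\mathbb{C}^m)$-valued reproducing kernel, on which pointwise (componentwise) multiplication by each polynomial is bounded, and in which $\mathbb{C}[\boldsymbol z]\otimes\mathbb{C}^m$ is a dense subspace; $\mathcal{H}$ is the case $m=1$, $D=\Omega$. Its kernel $K$ is $G$-invariant if $K(\sigma\boldsymbol z,\sigma\boldsymbol w)=K(\boldsymbol z,\boldsymbol w)$ for all $\sigma\in G$, $\boldsymbol z,\boldsymbol w\in\Omega$. $\mathcal H$ is viewed as a Hilbert module over $\mathbb{C}[\boldsymbol z]^G$ by restricting the module action $\mathfrak{m}_q f=qf$. Definition of $\Gamma$ and $\widetilde{\mathcal H}$: let $p_1,\ldots,p_d$ be a basis of $\mathbb{C}[\boldsymbol z]$ as a free $\mathbb{C}[\boldsymbol z]^G$-module. Every $f\in\mathcal{O}(\Omega)$ can be written uniquely as $f=\sum_{k=1}^d p_k\,(\tilde f_k\circ\boldsymbol\theta)$ with $\tilde f_k$ holomorphic on $\boldsymbol\theta(\Omega)$. Define $\Gamma f=\sum_{k=1}^d\tilde f_k\otimes\varepsilon_k$, with $\{\varepsilon_k\}$ the standard basis of $\mathbb{C}^d$; $\widetilde{\mathcal H}:=\Gamma\mathcal{H}$ with inner product $\langle\Gamma f,\Gamma g\rangle_{\widetilde{\mathcal H}}:=\langle f,g\rangle_{\mathcal{H}}$, and module action $\widetilde T_p(\sum_k\tilde f_k\otimes\varepsilon_k)=\sum_k(p\tilde f_k)\otimes\varepsilon_k$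 for $p\in\mathbb{C}[\boldsymbol z]$. Unitary equivalence here is taken with respect to the ring isomorphism $\mathbb{C}[\boldsymbol z]\to\mathbb{C}[\boldsymbol z]^G$, $p\mapsto p\circ\boldsymbol\theta$: there is a unitary $U:\mathcal{H}\to\widetilde{\mathcal H}$ with $\widetilde T_pU=U\mathfrak{m}_{p\circ\boldsymbol\theta}$ for all $p\in\mathbb{C}[\boldsymbol z]$. *)

(* Defs.v *)
From HB Require Import structures.
From mathcomp Require Import all_boot all_order all_algebra all_fingroup.
From mathcomp Require Import mxrepresentation complex.
From mathcomp Require Import all_classical all_reals.
From mathcomp Require Import ereal topology normedtype sequences derive.
From mathcomp Require mpoly.
(* The notations of mpoly are incompatible with those of the analysis library. *)
Import -(notations) mpoly.

Set Implicit Arguments.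
Unset Strict Implicit.
Unset Printing Implicit Defensive.

Import Order.TTheory GRing.Theory Num.Theory.
Import numFieldNormedType.Exports.
Local Open Scope ring_scope.
Local Open Scope classical_set_scope.

(* R[i] seen through the abstract interface on which the analysis library puts
   the topology and the normed module structure of a field. *)
Definition Cplx (R : realType) : numClosedFieldType := R[i].

Section PolynomialMaps.
Variables (R : realType) (n : nat).
Local Notation C := (Cplx R).

Definition peval (q : mpoly n C) (z : 'cV[C]_n) : C := meval (fun i => z i 0) q.

Definition polymap (m : nat) (q : 'I_m -> mpoly n C) (z : 'cV[C]_n) : 'cV[C]_m :=
  \col_i peval (q i) z.

End PolynomialMaps.

Section ReflectionGroups.
Variables (R : realType) (n : nat).
Local Notation C := (Cplx R).

Definition pseudoreflection (rho : 'M[C]_n) : Prop :=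
  [/\ rho \in unitmx,
      exists2 k : nat, (0 < k)%N & rho ^+ k = 1%:M
    & \rank (1%:M - rho) = 1%N].

(* A finite subgroup of GL(n, C) is given as the image of a finite group G under
   a faithful matrix representation rG; g in G acts on column vectors by
   z |-> rG g *m z. *)
Variables (gT : finGroupType) (G : {group gT}) (rG : mx_representation C G n).

Definition generated_by_pseudoreflections : Prop :=
  exists2 S : {set gT},
    (forall g, g \in S -> pseudoreflection (rG g)) & <<S>>%g = G.

Definition invariant_set (D : set 'cV[C]_n) : Prop :=
  forall g, g \in G -> (mulmx (rG g)) @` D = D.

Definition invariant_poly (q : mpoly n C) : Prop :=
  forall g, g \in G -> forall z, peval q (rG g *m z) = peval q z.

Record hsop (theta : n.-tuple (mpoly n C)) : Prop := {
  hsop_homog : forall i, tnth theta i \is ishomog mdeg;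
  hsop_invariant : forall i, invariant_poly (tnth theta i);
  hsop_algindep : forall q : mpoly n C, comp_mpoly theta q = 0 -> q = 0;
  hsop_generate : forall q : mpoly n C,
    invariant_poly q -> exists r : mpoly n C, q = comp_mpoly theta r
}.

(* Basis of C[z] as a module over its subring of invariant polynomials. *)
Record invariant_basis (d : nat) (p : 'I_d -> mpoly n C) : Prop := {
  ibasis_span : forall q : mpoly n C, exists2 c : 'I_d -> mpoly n C,
    (forall k, invariant_poly (c k)) & q = \sum_(k < d) c k * p k;
  ibasis_free : forall c : 'I_d -> mpoly n C,
    (forall k, invariant_poly (c k)) ->
    \sum_(k < d) c k * p k = 0 -> forall k, c k = 0
}.

End ReflectionGroups.

Section HilbertSpaces.
Variable R : realType.
Local Notation C := (Cplx R).

Definition hnorm (V : Type) (ip : V -> V -> C) (v : V) : R :=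
  Num.sqrt (complex.Re (ip v v)).

(* H is a linear subspace of V and ip restricts to an inner product on H, linear
   in its first argument, which makes H a Hilbert space. *)
Record hilbert_space (V : lmodType C) (H : set V) (ip : V -> V -> C) : Prop := {
  hilbert0 : H 0;
  hilbertP : forall (a : C) u v, H u -> H v -> H (a *: u + v);
  hilbert_linear : forall (a : C) u v w, H u -> H v -> H w ->
    ip (a *: u + v) w = a * ip u w + ip v w;
  hilbert_sym : forall u v, H u -> H v -> ip v u = (ip u v)^*;
  hilbert_pos : forall u, H u -> u != 0 -> 0 < ip u u;
  hilbert_complete : forall u : nat -> V, (forall i, H (u i)) ->
    (forall e : R, 0 < e -> exists N : nat, forall i j : nat,
      (N <= i)%N -> (N <= j)%N -> hnorm ip (u i - u j) < e) ->
    exists2 v, H v & hnorm ip (u i - v) @[i --> \oo] --> (0 : R)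
}.

Definition unitary (V W : lmodType C) (H : set V) (ipH : V -> V -> C)
    (L : set W) (ipL : W -> W -> C) (U : V -> W) : Prop :=
  [/\ U @` H = L,
      forall (a : C) u v, H u -> H v -> U (a *: u + v) = a *: U u + U v
    & forall u v, H u -> H v -> ipL (U u) (U v) = ipH u v].

End HilbertSpaces.

(* A C^m-valued function on a set D of C^n is encoded by its extension by 0 to
   C^n. *)
Section HolomorphicFunctions.
Variables (R : realType) (n : nat).
Local Notation C := (Cplx R).

Definition domain (D : set 'cV[C]_n) : Prop :=
  [/\ D !=set0, open D & connected D].

Definition ext0 (m : nat) (D : set 'cV[C]_n) (f : 'cV[C]_n -> 'cV[C]_m) :
  'cV[C]_n -> 'cV[C]_m := patch (fun=> 0) D f.

(* Holomorphy is complex Frechet differentiability at every point of D. *)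
Definition holomorphic_on (m : nat) (D : set 'cV[C]_n)
    (f : 'cV[C]_n -> 'cV[C]_m) : Prop :=
  ext0 D f = f /\ forall z, D z -> differentiable f z.

Definition pmul (m : nat) (q : mpoly n C) (f : 'cV[C]_n -> 'cV[C]_m) :
  'cV[C]_n -> 'cV[C]_m := fun z => peval q z *: f z.

Definition cdot (m : nat) (u v : 'cV[C]_m) : C :=
  \sum_(i < m) u i 0 * (v i 0)^*.

Definition reproducing_kernel (m : nat) (D : set 'cV[C]_n)
    (H : set ('cV[C]_n -> 'cV[C]_m))
    (ip : ('cV[C]_n -> 'cV[C]_m) -> ('cV[C]_n -> 'cV[C]_m) -> C)
    (K : 'cV[C]_n -> 'cV[C]_n -> 'M[C]_m) : Prop :=
  forall w, D w -> forall eta : 'cV[C]_m,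
    let Kw := ext0 D (fun z => K z w *m eta) in
    H Kw /\ forall f, H f -> ip f Kw = cdot (f w) eta.

Record analytic_hilbert_module (m : nat) (D : set 'cV[C]_n)
    (H : set ('cV[C]_n -> 'cV[C]_m))
    (ip : ('cV[C]_n -> 'cV[C]_m) -> ('cV[C]_n -> 'cV[C]_m) -> C) : Prop := {
  ahm_domain : domain D;
  ahm_hilbert : hilbert_space H ip;
  ahm_holomorphic : H `<=` holomorphic_on D;
  ahm_kernel : exists K, reproducing_kernel D H ip K;
  ahm_stable : forall q f, H f -> H (pmul q f);
  ahm_bounded : forall q, exists M : R, forall f, H f ->
    hnorm ip (pmul q f) <= M * hnorm ip f;
  ahm_poly : forall q : 'I_m -> mpoly n C, H (ext0 D (polymap q));
  ahm_dense : forall f, H f -> forall e : R, 0 < e ->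
    exists q : 'I_m -> mpoly n C, hnorm ip (f - ext0 D (polymap q)) < e
}.

End HolomorphicFunctions.

Section Gamma.
Variables (R : realType) (n d : nat).
Local Notation C := (Cplx R).
Variables (theta : n.-tuple (mpoly n C)) (p : 'I_d -> mpoly n C).
Variable Omega : set 'cV[C]_n.

Definition theta_map : 'cV[C]_n -> 'cV[C]_n := polymap (tnth theta).

(* F holds the coefficients of f in f = \sum_k p_k * (F_k \o theta). *)
Definition decomposition (f : 'cV[C]_n -> 'cV[C]_1) (F : 'cV[C]_n -> 'cV[C]_d) :
  Prop :=
  holomorphic_on (theta_map @` Omega) F /\
  forall z, Omega z -> f z 0 0 = \sum_(k < d) peval (p k) z * F (theta_map z) k 0.

(* The unique F such that decomposition f F; 0 is a dummy value. *)
Definition Gamma (f : 'cV[C]_n -> 'cV[C]_1) : 'cV[C]_n -> 'cV[C]_d :=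
  xget 0 [set F | decomposition f F].

Variable H : set ('cV[C]_n -> 'cV[C]_1).
Variable ip : ('cV[C]_n -> 'cV[C]_1) -> ('cV[C]_n -> 'cV[C]_1) -> C.

Definition Gamma_space : set ('cV[C]_n -> 'cV[C]_d) := Gamma @` H.

(* The value <f, g> for any f and g in H with Gamma f = F1 and Gamma g = F2. *)
Definition Gamma_ip (F1 F2 : 'cV[C]_n -> 'cV[C]_d) : C :=
  xget 0 [set c | exists f g,
    [/\ H f, H g, F1 = Gamma f, F2 = Gamma g & c = ip f g]].

End Gamma.

(* Main.v *)
Require Import Defs.
From HB Require Import structures.
From mathcomp Require Import all_boot all_order all_algebra all_fingroup.
From mathcomp Require Import mxrepresentation complex.
From mathcomp Require Import all_classical all_reals.
From mathcomp Require Import ereal topology normedtype sequences derive.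
From mathcomp Require mpoly.
Import -(notations) mpoly.
From mathcomp Require Import spectral landau ring lra zify.

Set Implicit Arguments.
Unset Strict Implicit.
Unset Printing Implicit Defensive.

Import Order.TTheory GRing.Theory Num.Theory.
Import numFieldNormedType.Exports.
Local Open Scope ring_scope.
Local Open Scope classical_set_scope.

(** The coefficient map [Gamma] is an isometry onto its range by the definition of
    the inner product on the range, so the content of the theorem is that every
    [f] in [H] has a decomposition [\sum_k p_k * (F_k \o theta)] with [F_k]
    holomorphic on [theta @` Omega], that it is unique, that [theta @` Omega] is a
    domain, and that the point evaluations [f |-> F_k w] are continuous on [H].

    Since polynomials are dense in [H], everything is reduced to estimates on
    polynomials, where the analysis is elementary and uses no integrals. A
    polynomial [q] has unique coordinates [Q_k], with
    [q = \sum_k p_k * (Q_k \o theta)]. The values of [q] on the orbit of [z]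
    determine the numbers [Q_k (theta z)] by a linear system whose determinant
    [orbit_det] is a non zero polynomial in [z]: on a free orbit all functions
    are combinations of the [p_k], by interpolation. Cramer's formula bounds
    [Q_k \o theta] where [orbit_det] is away from [0], and Cauchy's estimate for
    polynomials on a small circle in a suitable complex line
    ([coef_circle_bound]) gives a bound at every point ([coords_bound]).
    The values of [q] near an orbit are bounded by a multiple of its norm in [H]:
    the norms of the reproducing kernels are locally bounded by the uniform
    boundedness principle ([gliding_hump]) and are constant on orbits by the
    invariance of [K].

    Hence, locally uniformly in [w], [q |-> Q_k w] is bounded for the norm of
    [H], and Riesz' theorem on a dense subspace ([riesz_dense]) yields
    [coef_kernel k w] in [H] representing it. The products
    [ip f (coef_kernel k w)] are the coefficients [F_k w] of [f]
    ([coef_map]). An identity or an estimate between functionals that holds for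
    polynomials holds on [H]; this gives the decomposition
    ([coef_map_decomposes]) and, from the Taylor estimate
    [colval_taylor_bound] applied to the [Q_k], the differentiability of the
    [F_k] ([coef_map_differentiable]).

    That [theta] is onto comes from a common eigenvector of the multiplications by
    the coordinates on the fibre algebra, which has the [p_k] as a basis
    ([quotient_map_surj]); that it is open follows from the norms over [G]
    of sufficiently many linear forms ([quotient_map_open]). *)

(** * Polynomials in one variable on circles *)

Section OneVariable.
Variable C : numClosedFieldType.
Implicit Types (P S : {poly C}) (r M : C).

(** Cauchy's estimate. If [P = E(X^2) + X O(X^2)], then [2 E(x^2)] and
    [2 x O(x^2)] are the sum and the difference of [P x] and [P (- x)]; as every
    point of the circle of radius [r ^+ 2] is a square, the polynomials [E] and
    [O], of about half the size, satisfy similar bounds on that circle. *)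
Lemma coef_circle_bound P r M : 0 < r ->
  (forall x, `|x| = r -> `|P.[x]| <= M) -> forall i, `|P`_i| * r ^+ i <= M.
Proof.
have [m] := ubnP (size P); elim: m => // m IH in P r M *.
rewrite ltnS => szP r0 bP i.
have M0 : 0 <= M.
  by apply: le_trans (normr_ge0 _) (bP r _); rewrite ger0_norm ?ltW.
have [sz1|sz2] := leqP (size P) 1.
  have Pc := size1_polyC sz1.
  case: i => [|i].
    rewrite expr0 mulr1; have := bP r; rewrite Pc hornerC coefC eqxx.
    by apply; rewrite ger0_norm ?ltW.
  by rewrite Pc coefC normr0 mul0r.
have szE : (size (even_poly P) < m)%N.
  apply: leq_ltn_trans (size_even_poly P) _; apply: leq_trans szP.
  by case: (size P) sz2 => [|[|s]] //= _; rewrite !ltnS uphalfE; lia.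
have szO : (size (odd_poly P) < m)%N.
  apply: leq_ltn_trans (size_odd_poly P) _; apply: leq_trans szP.
  by case: (size P) sz2 => [|[|s]] //= _; rewrite !ltnS; lia.
have r20 : 0 < r ^+ 2 by rewrite exprn_gt0.
have sqrtr x : `|x| = r ^+ 2 -> `|sqrtC x| = r.
  move=> xr; apply/eqP; rewrite -(@eqrXn2 _ 2) ?normr_ge0 ?ltW//.
  by rewrite -normrX sqrtCK xr.
have splitP y : P.[y] = (even_poly P).[y ^+ 2] + (odd_poly P).[y ^+ 2] * y.
  by rewrite -{1}(poly_even_odd P) hornerD hornerMX !horner_comp hornerXn.
have bE x : `|x| = r ^+ 2 -> `|(even_poly P).[x]| <= M.
  move=> xr; have sx := sqrtr _ xr.
  have -> : (even_poly P).[x] = (P.[sqrtC x] + P.[- sqrtC x]) / 2%:R.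
    by rewrite !splitP sqrrN sqrtCK; field.
  rewrite normrM normfV normr_nat ler_pdivrMr ?ltr0n// mulr_natr mulr2n.
  by apply: le_trans (ler_normD _ _) _; apply: lerD; apply: bP; rewrite ?normrN.
have bO x : `|x| = r ^+ 2 -> `|(odd_poly P).[x]| <= M / r.
  move=> xr; have sx := sqrtr _ xr.
  have sx0 : sqrtC x != 0 by rewrite -normr_gt0 sx.
  have -> : (odd_poly P).[x] = (P.[sqrtC x] - P.[- sqrtC x]) / (2%:R * sqrtC x).
    by rewrite !splitP sqrrN sqrtCK; field.
  rewrite normrM normfV normrM normr_nat sx invfM mulrA ler_pM2r ?invr_gt0//.
  rewrite ler_pdivrMr ?ltr0n// mulr_natr mulr2n.
  by apply: le_trans (ler_normB _ _) _; apply: lerD; apply: bP; rewrite ?normrN.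
rewrite -(odd_double_half i); case: (odd i); rewrite ?add1n ?add0n.
  have := IH _ _ _ szO r20 bO i./2.
  rewrite coef_odd_poly ler_pdivlMr// -exprM mul2n.
  by rewrite -mulrA -exprSr.
by have := IH _ _ _ szE r20 bE i./2; rewrite coef_even_poly -exprM mul2n.
Qed.

(** Comparison with a geometric series of ratio [1 / 2]. *)
Lemma horner_half_disc_bound P r M (x : C) : 0 < r ->
  (forall i, `|P`_i| * r ^+ i <= M) -> `|x| <= r / 2%:R ->
  `|P.[x]| <= 2%:R * M.
Proof.
move=> r0; elim/poly_ind: P M => [|P c IH] M bP xr.
  by rewrite horner0 normr0 mulr_ge0// (le_trans _ (bP 0))// coef0 normr0 mul0r.
have {}IH : `|P.[x]| <= 2%:R * (M / r).
  apply: IH => // i; rewrite ler_pdivlMr// -mulrA -exprSr.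
  by have := bP i.+1; rewrite coefD coefMX coefC /= addr0.
have c0 : `|c| <= M.
  by have := bP 0; rewrite coefD coefMX coefC /= add0r expr0 mulr1.
rewrite hornerMXaddC; apply: le_trans (ler_normD _ _) _.
have -> : 2%:R * M = (2%:R * (M / r)) * (r / 2%:R) + M.
  by field; rewrite gt_eqF.
by apply: lerD => //; rewrite normrM ler_pM.
Qed.

Lemma taylor_circle_bound P r M (x : C) : 0 < r ->
  (forall x, `|x| = r -> `|P.[x]| <= M) -> `|x| <= r / 2%:R ->
  `|P.[x] - P`_0 - P`_1 * x| <= 2%:R * M * (`|x| / r) ^+ 2.
Proof.
move=> r0 bP xr; have cP := coef_circle_bound r0 bP.
have r20 : 0 < r ^+ 2 by rewrite exprn_gt0.
have -> : P.[x] - P`_0 - P`_1 * x = (drop_poly 2 P).[x] * x ^+ 2.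
  rewrite -{1}(poly_take_drop 2 P) hornerD hornerM hornerXn.
  rewrite /take_poly horner_poly 2!big_ord_recl big_ord0 /= /=; ring.
have -> : 2%:R * M * (`|x| / r) ^+ 2 = 2%:R * (M / r ^+ 2) * `|x| ^+ 2.
  by field; rewrite gt_eqF.
rewrite normrM normrX.
apply: ler_wpM2r; first by rewrite exprn_ge0.
apply: horner_half_disc_bound r0 _ xr => i.
rewrite coef_drop_poly ler_pdivlMr// -mulrA -exprD; exact: cP.
Qed.

Lemma horner_near0 P e : 0 < e ->
  exists2 d, 0 < d & forall x, `|x| <= d -> `|P.[x] - P.[0]| <= e.
Proof.
elim/poly_ind: P e => [|P c _] e e0.
  by exists 1 => // x _; rewrite !horner0 subrr normr0 ltW.
pose B := \sum_(i < size P) `|P`_i|.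
have B1 : 0 < B + 1 by rewrite ltr_wpDl// sumr_ge0.
have B1e : 0 < B + 1 + e by rewrite addr_gt0.
exists (e / (B + 1 + e)); first by rewrite divr_gt0.
move=> x xd; have x1 : `|x| <= 1.
  by rewrite (le_trans xd)// ler_pdivrMr// mul1r lerDr ltW.
have PB : `|P.[x]| <= B.
  rewrite horner_coef; apply: le_trans (ler_norm_sum _ _ _) _.
  apply: ler_sum => i _; rewrite normrM normrX ler_piMr//.
  by rewrite exprn_ile1.
rewrite !hornerMXaddC mulr0 add0r addrK normrM.
apply: (@le_trans _ _ (B * (e / (B + 1 + e)))); first exact: ler_pM.
rewrite mulrA ler_pdivrMr// mulrC ler_wpM2l ?ltW//.
by rewrite -addrA ltrDl addr_gt0.
Qed.

(** Near [0] the polynomial behaves like its lowest term [a X^m], so that it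
    stays away from [0] on every small circle. *)
Lemma small_circle_away P e : P != 0 -> 0 < e ->
  exists r c, [/\ 0 < r, r <= e, 0 < c &
    forall x, `|x| = r -> c <= `|P.[x]|].
Proof.
move=> P0 e0; have [m [S /implyP/(_ P0) S0 PE]] := multiplicity_XsubC P 0.
rewrite subr0 in PE; rewrite rootE in S0.
have s0 : 0 < `|S.[0]| / 2%:R by rewrite divr_gt0 ?normr_gt0 ?ltr0n.
have [d d0 Sd] := horner_near0 S s0.
pose r := d * e / (d + e).
have de0 : 0 < d + e by rewrite addr_gt0.
have r0 : 0 < r by rewrite divr_gt0 ?mulr_gt0.
have rd : r <= d by rewrite ler_pdivrMr// ler_wpM2l ?ltW// ltrDr.
have re : r <= e by rewrite ler_pdivrMr// mulrC ler_wpM2l ?ltW// ltrDl.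
exists r, (`|S.[0]| / 2%:R * r ^+ m); split=> //; first by rewrite mulr_gt0 ?exprn_gt0.
move=> x xr; rewrite PE hornerM hornerXn normrM normrX xr.
apply: ler_wpM2r; first by rewrite exprn_ge0// ltW.
have := Sd x; rewrite xr => /(_ rd); rewrite distrC => Sx.
have := ler_normD (S.[0] - S.[x]) S.[x]; rewrite subrK.
move=> /le_trans/(_ (lerD Sx (lexx _))).
by rewrite [X in X <= _ -> _]splitr lerD2l.
Qed.

End OneVariable.

(** * Polynomials in several variables *)

Section ColumnNorm.
Variables (C : numFieldType) (n : nat).
Implicit Types z : 'cV[C]_n.

Lemma norm_coord_le z i : `|z i 0| <= `|z|.
Proof. by rewrite [leRHS]mx_normE -[leLHS]nngE num_le; exact: (le_bigmax _ _ (i, 0)). Qed.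

Lemma norm_col_le z M : 0 <= M -> (forall i, `|z i 0| <= M) -> `|z| <= M.
Proof.
move=> M0 zM; have nE : `|z| = mx_norm z by [].
have [z0|/mx_norm_neq0[[i j]]] := eqVneq (mx_norm z) 0; first by rewrite nE z0.
by rewrite nE ord1 => ->.
Qed.

End ColumnNorm.

Section Polynomials.
Variables (C : numClosedFieldType) (n : nat).
Implicit Types (q : mpoly n C) (z v : 'cV[C]_n).

Lemma mpoly_ring_ind (P : mpoly n C -> Prop) :
  (forall c, P (mpolyC n c)) -> (forall i, P (mpolyX C (mnm1 i))) ->
  (forall q1 q2, P q1 -> P q2 -> P (q1 + q2)) ->
  (forall q1 q2, P q1 -> P q2 -> P (q1 * q2)) -> forall q, P q.
Proof.
move=> PC PX PD PM; elim/mpolyind => [|c m q _ _ Pq]; first by rewrite -(mpolyC0 n).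
apply: (PD) => //; rewrite -mul_mpolyC; apply: (PM) => //.
have P1 : P 1 by rewrite -mpolyC1.
rewrite mpolyXE_id; elim/big_ind : _ => // i _.
by elim: (m i) => [|k IH]; rewrite ?expr0// exprS; exact: PM.
Qed.

(** [peval] over an arbitrary algebraically closed numeric field. *)
Definition colval q z : C := meval (fun i => z i 0) q.

Lemma colvalC c z : colval (mpolyC n c) z = c.
Proof. exact: mevalC. Qed.

Lemma colvalXU i z : colval (mpolyX C (mnm1 i)) z = z i 0.
Proof. exact: mevalXU. Qed.

Lemma colvalD q1 q2 z : colval (q1 + q2) z = colval q1 z + colval q2 z.
Proof. exact: mevalD. Qed.

Lemma colvalM q1 q2 z : colval (q1 * q2) z = colval q1 z * colval q2 z.
Proof. exact: mevalM. Qed.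

Lemma colvalB q1 q2 z : colval (q1 - q2) z = colval q1 z - colval q2 z.
Proof. exact: mevalB. Qed.

Lemma colvalZ c q z : colval (c *: q) z = c * colval q z.
Proof. exact: mevalZ. Qed.

Lemma colval0 z : colval 0 z = 0.
Proof. exact: meval0. Qed.

Lemma colval1 z : colval 1 z = 1.
Proof. exact: meval1. Qed.

Lemma colval_sum (I : Type) (s : seq I) (P : pred I) (F : I -> mpoly n C) z :
  colval (\sum_(i <- s | P i) F i) z = \sum_(i <- s | P i) colval (F i) z.
Proof. exact: raddf_sum. Qed.

Lemma colval_prod (I : Type) (s : seq I) (P : pred I) (F : I -> mpoly n C) z :
  colval (\prod_(i <- s | P i) F i) z = \prod_(i <- s | P i) colval (F i) z.
Proof. exact: rmorph_prod. Qed.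

Lemma colval_lipschitz q (B : C) : 0 <= B -> exists2 M, 0 <= M &
  forall z v, `|z| <= B -> `|v| <= B ->
    `|colval q z| <= M /\ `|colval q z - colval q v| <= M * `|z - v|.
Proof.
move=> B0; elim/mpoly_ring_ind: q => [c|i|q1 q2|q1 q2].
- exists `|c| => // z v _ _; rewrite !colvalC subrr; split=> //.
  by rewrite normr0 mulr_ge0.
- exists (B + 1) => [|z v zB vB]; first by rewrite addr_ge0.
  rewrite !colvalXU; split.
    by rewrite (le_trans (norm_coord_le _ _))// (le_trans zB)// lerDl.
  have := norm_coord_le (z - v) i; rewrite !mxE => /le_trans; apply.
  by rewrite ler_peMl// lerDr.
- move=> [M1 M10 H1] [M2 M20 H2]; exists (M1 + M2) => [|z v zB vB].
    exact: addr_ge0.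
  have [H1a H1b] := H1 _ _ zB vB; have [H2a H2b] := H2 _ _ zB vB.
  rewrite !colvalD; split; first by rewrite (le_trans (ler_normD _ _))// lerD.
  by rewrite opprD addrACA (le_trans (ler_normD _ _))// mulrDl lerD.
- move=> [M1 M10 H1] [M2 M20 H2].
  exists (M1 * M2 + M1 * M2) => [|z v zB vB]; first by rewrite addr_ge0 ?mulr_ge0.
  have [H1a H1b] := H1 _ _ zB vB; have [H2a H2b] := H2 _ _ zB vB.
  have [H1c _] := H1 _ _ vB zB.
  rewrite !colvalM; split.
    by rewrite normrM (le_trans (ler_pM _ _ H1a H2a))// lerDl mulr_ge0.
  have -> : colval q1 z * colval q2 z - colval q1 v * colval q2 v =
    (colval q1 z - colval q1 v) * colval q2 z + colval q1 v * (colval q2 z - colval q2 v).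
    by ring.
  rewrite (le_trans (ler_normD _ _))// !normrM mulrDl lerD//.
    by rewrite mulrAC; exact: ler_pM.
  by rewrite -mulrA; exact: ler_pM.
Qed.

Lemma colval_near q z (e : C) : 0 < e -> exists2 d, 0 < d &
  forall v, `|v - z| < d -> `|colval q v - colval q z| < e.
Proof.
move=> e0; have B0 : 0 <= `|z| + 1 by rewrite addr_ge0.
have [M M0 qM] := colval_lipschitz q B0.
have M10 : 0 < M + 1 + e by rewrite addr_gt0// ltr_wpDl.
exists (e / (M + 1 + e)) => [|v vz]; first by rewrite divr_gt0.
have vz1 : `|v - z| <= 1.
  by rewrite (le_trans (ltW vz))// ler_pdivrMr// mul1r lerDr addr_ge0.
have [||_ /le_lt_trans] := qM v z; last apply.
- by rewrite -[v](subrK z) addrC (le_trans (ler_normD _ _))// lerD2l.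
- by rewrite lerDl.
rewrite (@le_lt_trans _ _ (M * (e / (M + 1 + e))))//.
  by rewrite ler_wpM2l// ltW.
rewrite mulrCA gtr_pMr// ltr_pdivrMr// mul1r -addrA ltrDl.
by rewrite addr_gt0.
Qed.

Lemma colval_continuous q : continuous (colval q).
Proof.
move=> z; apply/(@cvgrPdistC_lt _ _ _ (nbhs z)) => e /(colval_near q z)[d d0 dq].
apply/(@nbhs_normP C 'cV[C]_n z); exists d => // v /=; rewrite distrC; exact: dq.
Qed.

Definition pgrad q z : 'rV[C]_n := \row_i colval (mderiv i q) z.

Lemma pgradD q1 q2 z i : pgrad (q1 + q2) z 0 i = pgrad q1 z 0 i + pgrad q2 z 0 i.
Proof. by rewrite !mxE mderivD colvalD. Qed.

Lemma pgradZ a q z i : pgrad (a *: q) z 0 i = a * pgrad q z 0 i.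
Proof. by rewrite !mxE mderivZ colvalZ. Qed.

(** A polynomial restricted to an affine line is a polynomial in one variable;
    this reduces all the estimates below to one variable. *)
Lemma colval_line q z v : exists P : {poly C},
  (forall x : C, P.[x] = colval q (z + x *: v)) /\ P`_1 = (pgrad q z *m v) 0 0.
Proof.
elim/mpoly_ring_ind: q => [c|i|q1 q2|q1 q2].
- exists c%:P; split=> [x|]; first by rewrite hornerC colvalC.
  rewrite coefC /= mxE big1// => i _; rewrite mxE mderivC colval0 mul0r//.
- exists ((v i 0)%:P * 'X + (z i 0)%:P); split=> [x|].
    by rewrite hornerMXaddC hornerC colvalXU !mxE addrC mulrC.
  rewrite coefD coefMX !coefC /= addr0 mxE (bigD1 i)//= big1 ?addr0 => [|j ji].
    rewrite mxE mderivX mnm1E eqxx scale1r.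
    by rewrite /colval mevalX big1 ?mul1r// => j _; rewrite mnmBE subnn.
  by rewrite mxE mderivX mnm1E eq_sym (negbTE ji) scale0r colval0 mul0r.
- move=> [P1 [H1 D1]] [P2 [H2 D2]]; exists (P1 + P2); split=> [x|].
    by rewrite hornerD H1 H2 colvalD.
  rewrite coefD D1 D2 !mxE -big_split; apply: eq_bigr => i _.
  by rewrite !mxE mderivD colvalD mulrDl.
- move=> [P1 [H1 D1]] [P2 [H2 D2]]; exists (P1 * P2); split=> [x|].
    by rewrite hornerM H1 H2 colvalM.
  have E1 : P1`_0 = colval q1 z by rewrite -horner_coef0 H1 scale0r addr0.
  have E2 : P2`_0 = colval q2 z by rewrite -horner_coef0 H2 scale0r addr0.
  rewrite coefM 2!big_ord_recl big_ord0 /= E1 E2 D1 D2 !mxE addr0.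
  rewrite mulr_sumr mulr_suml -big_split; apply: eq_bigr => i _.
  by rewrite !mxE mderivM colvalD !colvalM /=; ring.
Qed.

(** The maximum principle on a disc in the direction [v]: along that line the
    value at the centre is the constant coefficient. *)
Lemma colval_center_bound q z v (r M : C) : 0 < r ->
  (forall x, `|x| = r -> `|colval q (z + x *: v)| <= M) -> `|colval q z| <= M.
Proof.
move=> r0 qM; have [P [PE _]] := colval_line q z v.
have := @coef_circle_bound _ P r M r0 _ 0.
rewrite expr0 mulr1 -horner_coef0 PE scale0r addr0; apply=> x.
by rewrite PE; exact: qM.
Qed.

Lemma pgrad_bound q z (r M : C) i : 0 < r ->
  (forall v, `|v - z| <= r -> `|colval q v| <= M) -> `|pgrad q z 0 i| * r <= M.
Proof.
move=> r0 qM; have [P [PE PD]] := colval_line q z (delta_mx i 0).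
have -> : pgrad q z 0 i = P`_1.
  rewrite PD [RHS]mxE (bigD1 i)//= big1 ?addr0 => [|j ji].
    by rewrite [delta_mx _ _ _ _]mxE !eqxx mulr1.
  by rewrite [delta_mx _ _ _ _]mxE (negbTE ji) mulr0.
have := @coef_circle_bound _ P r M r0 _ 1.
rewrite expr1; apply=> x xr; rewrite PE; apply: qM.
rewrite addrC addKr normrZ xr; apply: ler_piMr; first exact: ltW.
by apply: norm_col_le => // j; rewrite mxE andbT; case: eqP; rewrite ?normr1 ?normr0.
Qed.

(** The line is the one in the direction [h], on which [z + h] has parameter
    [1] and the circle has radius [r / `|h|]. *)
Lemma colval_taylor_bound q z (r M : C) h : 0 < r ->
  (forall v, `|v - z| <= r -> `|colval q v| <= M) -> `|h| <= r / 2%:R ->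
  `|colval q (z + h) - colval q z - (pgrad q z *m h) 0 0| <=
  2%:R * M * (`|h| / r) ^+ 2.
Proof.
move=> r0 qM hr; have [P [PE PD]] := colval_line q z h.
have P0 : P`_0 = colval q z by rewrite -horner_coef0 PE scale0r addr0.
have [->|h0] := eqVneq h 0.
  by rewrite mulmx0 addr0 [X in _ - X]mxE !subrr !normr0 mul0r expr0n mulr0.
have nh0 : 0 < `|h| by rewrite normr_gt0.
have := @taylor_circle_bound _ P (r / `|h|) M 1 (divr_gt0 r0 nh0).
rewrite PE scale1r P0 PD mulr1 normr1 div1r invf_div; apply=> [x xr|].
  rewrite PE; apply: qM; rewrite addrC addKr normrZ xr divfK// gt_eqF//.
by rewrite mulrAC ler_pdivlMr// mul1r.
Qed.

End Polynomials.

(** * Linear forms on the moment curve *)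

(** In a field whose order is only partial, half the harmonic mean replaces the
    minimum. *)
Lemma pos_lower_bound (C : numFieldType) (a b : C) : 0 < a -> 0 < b ->
  exists d, [/\ 0 < d, d <= a & d <= b].
Proof.
move=> a0 b0; have ab0 : 0 < a + b by rewrite addr_gt0.
exists (a * b / (a + b)); split; first by rewrite divr_gt0 ?mulr_gt0.
  by rewrite ler_pdivrMr// ler_wpM2l ?ltW// ltrDr.
by rewrite ler_pdivrMr// mulrC ler_wpM2l ?ltW// ltrDl.
Qed.

Lemma continuous_col (C : numFieldType) (T : topologicalType) (m : nat)
    (f : T -> 'cV[C]_m) (z : T) :
  (forall i, {for z, continuous (fun x => f x i 0)}) -> {for z, continuous f}.
Proof.
move=> fi; apply/(@cvgrPdistC_lt _ _ _ (nbhs z)) => e e0.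
have e20 : 0 < e / 2 by rewrite divr_gt0.
have H : \forall x \near nbhs z, forall i, `|f x i 0 - f z i 0| < e / 2.
  apply: filter_forall => i.
  exact: (proj1 (@cvgrPdistC_lt _ _ _ (nbhs z) _ _ _) (fi i)).
apply: filterS H => x fx; rewrite (@le_lt_trans _ _ (e / 2))//; last first.
  by rewrite ltr_pdivrMr// mulr_natr mulr2n ltrDl.
by apply: norm_col_le => [|i]; [exact: ltW|rewrite !mxE ltW].
Qed.

Lemma col_lincombE (C : pzRingType) m (a : C) (u v : 'cV[C]_m) k :
  (a *: u + v) k 0 = a * u k 0 + v k 0.
Proof. by rewrite !mxE. Qed.

Lemma col_subE (C : pzRingType) m (u v : 'cV[C]_m) k : (u - v) k 0 = u k 0 - v k 0.
Proof. by rewrite !mxE. Qed.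

Section MomentForms.
Variables (C : numFieldType) (n : nat).
Implicit Types (y : 'cV[C]_n).

Definition moment_form (s : nat) y : C := \sum_(i < n) s%:R ^+ i * y i 0.

(** Any [n] of the forms [moment_form s] are linearly independent, by the
    Vandermonde determinant; the constant is uniform as there are finitely many
    choices of [n] forms. *)
Lemma norm_le_moment_forms m : exists2 K : C, 0 < K &
  forall (f : 'I_n -> 'I_m) y e, injective f ->
    (forall j, `|moment_form (f j) y| <= e) -> 0 <= e -> `|y| <= K * e.
Proof.
pose V (f : {ffun 'I_n -> 'I_m}) : 'M[C]_n := (Vandermonde n (\row_j (f j)%:R))^T.
pose K : C := 1 + \sum_f \sum_i \sum_j `|invmx (V f) i j|.
have Kf0 f i : 0 <= \sum_j `|invmx (V f) i j| by rewrite sumr_ge0.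
have Kf1 f : 0 <= \sum_i \sum_j `|invmx (V f) i j| by rewrite sumr_ge0.
exists K; first by rewrite ltr_pwDl// sumr_ge0.
move=> f y e f_inj fe e0; pose g := [ffun j => f j].
have uV : V g \in unitmx.
  rewrite unitmx_tr unitmxE det_Vandermonde unitfE.
  apply/prodf_neq0 => i _; apply/prodf_neq0 => j ij.
  rewrite !mxE subr_eq0 eqr_nat !ffunE; apply: contraTneq ij => /ord_inj/f_inj ->.
  by rewrite ltnn.
apply: norm_col_le => [|i]; first by rewrite mulr_ge0// addr_ge0// sumr_ge0.
rewrite -(mulKmx uV y) mxE; apply: le_trans (ler_norm_sum _ _ _) _.
apply: (@le_trans _ _ ((\sum_j `|invmx (V g) i j|) * e)).
  rewrite mulr_suml; apply: ler_sum => j _; rewrite normrM ler_wpM2l//.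
  rewrite mxE; have := fe j; rewrite /moment_form; congr (`|_| <= _).
  by apply: eq_bigr => k _; rewrite !mxE ffunE.
rewrite ler_wpM2r//.
apply: (@le_trans _ _ (\sum_i \sum_j `|invmx (V g) i j|)).
  by rewrite [leRHS](bigD1 i)//= lerDl sumr_ge0.
by rewrite /K (bigD1 g)//= addrCA lerDl addr_ge0// sumr_ge0.
Qed.

(** With more than [n * #|I|] forms, one of the vectors serves more than [n] of
    them by the pigeonhole principle, and [n] moment forms determine a vector. *)
Lemma small_moment_forms (I : finType) : exists2 K : C, 0 < K &
  forall (A : pred I) (y : I -> 'cV[C]_n) e, 0 <= e ->
    (forall s : 'I_(n * #|I|).+1, exists2 g, A g & `|moment_form s (y g)| <= e) ->
    exists2 g, A g & `|y g| <= K * e.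
Proof.
have [K K0 KP] := norm_le_moment_forms (n * #|I|).+1.
exists K => // A y e e0 /(_ _)/cid2 H.
pose c s := s2val (H s); have cA s : A (c s) := s2valP (H s).
have ce (s : 'I_(n * #|I|).+1) : `|moment_form s (y (c s))| <= e := s2valP' (H s).
have [g gn] : exists g, (n < #|[set s | c s == g]%SET|)%N.
  apply/existsP; rewrite -[X in is_true X]negbK negb_exists; apply/negP => /forallP cn.
  have S : (\sum_(g : I) #|[set s | c s == g]%SET| = (n * #|I|).+1)%N.
    rewrite -[RHS]card_ord -[RHS]sum1_card (partition_big c xpredT)//=.
    by apply: eq_bigr => g _; rewrite sum1dep_card.
  have : (\sum_(g : I) #|[set s | c s == g]%SET| <= \sum_(g : I) n)%N.
    by apply: leq_sum => g _; rewrite leqNgt.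
  by rewrite S sum_nat_const mulnC ltnn.
have [s] : exists s, s \in [set s | c s == g]%SET.
  by apply/card_gt0P; apply: leq_ltn_trans gn.
rewrite inE => /eqP sg; exists g; first by rewrite -sg.
pose f (j : 'I_n) := enum_val (widen_ord (ltnW gn) j).
have f_inj : injective f.
  by move=> i j /enum_val_inj/(congr1 val)/= ij; exact: val_inj.
apply: (KP f) => // j.
have := enum_valP (widen_ord (ltnW gn) j); rewrite inE => /eqP cg.
by have := ce (f j); rewrite cg.
Qed.

(** Evaluated along the moment curve, a non zero row is a non zero polynomial in
    one variable; a point where the product of these polynomials does not vanish
    suits all the rows. *)
Lemma moment_vector_nonorthogonal (I : finType) (A : I -> 'rV[C]_n) :
  (forall g, A g != 0) -> exists z : 'cV[C]_n, forall g, A g *m z != 0.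
Proof.
move=> A0; pose P g : {poly C} := \poly_(i < n) (if insub i is Some j then A g 0 j else 0).
have PE g (j : 'I_n) : (P g)`_j = A g 0 j by rewrite coef_poly ltn_ord valK.
have P0 g : P g != 0.
  apply: contra_neq (A0 g) => Pg0; apply/rowP => j.
  by rewrite -PE Pg0 coef0 mxE.
have Q0 : \prod_g P g != 0 by apply/prodf_neq0 => g _.
have [s sQ] : exists s : 'I_(size (\prod_g P g)), (\prod_g P g).[s%:R] != 0.
  apply/existsP; rewrite -[X in is_true X]negbK negb_exists; apply/negP => /forallP sP.
  pose rs : seq C := [seq k%:R | k <- iota 0 (size (\prod_g P g))].
  have rs_root : all (root (\prod_g P g)) rs.
    apply/allP => x /mapP[k]; rewrite mem_iota add0n => /= kQ ->.
    by have := sP (Ordinal kQ); rewrite negbK.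
  have rs_uniq : uniq rs.
    by rewrite map_inj_uniq ?iota_uniq// => i j /eqP; rewrite eqr_nat => /eqP.
  by have := max_poly_roots Q0 rs_root rs_uniq; rewrite size_map size_iota ltnn.
exists (\col_i s%:R ^+ i) => g; apply: contra_neq sQ => /matrixP/(_ 0 0).
rewrite !mxE horner_prod => Ag; rewrite (bigD1 g)//= -[X in X * _](_ : 0 = _) ?mul0r//.
rewrite -Ag horner_poly; apply: eq_bigr => i _.
by rewrite valK mxE.
Qed.

End MomentForms.

(** * Finite linear groups acting on polynomials *)

Section GroupAction.
Variables (C : numClosedFieldType) (n : nat).
Variables (gT : finGroupType) (G : {group gT}) (rG : mx_representation C G n).
Implicit Types (q : mpoly n C) (z : 'cV[C]_n) (g : gT).

Definition invariant q : Prop :=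
  forall g, g \in G -> forall z, colval q (rG g *m z) = colval q z.

Definition translate g q : mpoly n C :=
  comp_mpoly [tuple \sum_j rG g i j *: mpolyX C (mnm1 j) | i < n] q.

Lemma colval_translate g q z : colval (translate g q) z = colval q (rG g *m z).
Proof.
rewrite /colval comp_mpoly_meval; apply: meval_eq => i.
rewrite tnth_mktuple raddf_sum mxE; apply: eq_bigr => j _ /=.
by rewrite mevalZ mevalXU.
Qed.

Lemma repr_mulKV g z : g \in G -> rG g^-1%g *m (rG g *m z) = z.
Proof. by move=> gG; rewrite mulmxA -repr_mxM ?groupV// mulVg repr_mx1 mul1mx. Qed.

Lemma invariant_norm q : invariant (\prod_(g in G) translate g q).
Proof.
move=> h hG z; rewrite !colval_prod [RHS](reindex_inj (mulIg h)) /=.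
apply: eq_big => [g|g gG]; first by rewrite groupMr.
by rewrite !colval_translate repr_mxM// mulmxA.
Qed.

Lemma free_orbit_point : mx_faithful rG ->
  exists z, forall g, g \in G -> rG g *m z = z -> g = 1%g.
Proof.
move=> rG_faithful.
have rG1 g : g \in G -> g != 1%g -> exists i, row i (rG g - 1%:M) != 0.
  move=> gG g1; apply/existsP; rewrite -[X in is_true X]negbK negb_exists.
  apply/negP => /forallP r0; case/negP: g1.
  suff /(fintype.subsetP rG_faithful)/set1gP -> : g \in rker rG by [].
  apply/rkerP; split=> //.
  apply/eqP; rewrite -subr_eq0; apply/eqP/row_matrixP => i; rewrite row0.
  by apply/eqP; have := r0 i; rewrite negbK.
pose A g : 'rV[C]_n := if [pick i | row i (rG g - 1%:M) != 0] is Some i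
  then row i (rG g - 1%:M) else 0.
have A0 : forall u : {g | (g \in G) && (g != 1%g)}, A (val u) != 0.
  case=> g /= /andP[gG g1]; rewrite /A; case: pickP => // r0.
  by have [i ri] := rG1 g gG g1; rewrite r0 in ri.
have [z zP] := moment_vector_nonorthogonal A0.
exists z => g gG gz; apply/eqP; apply: contraT => g1.
have gP : (g \in G) && (g != 1%g) by rewrite gG.
have := zP (exist _ g gP); rewrite /A /=; case: pickP => [i _|_]; last by rewrite mul0mx eqxx.
by rewrite -row_mul mulmxBl mul1mx gz subrr row0 eqxx.
Qed.

End GroupAction.

Section Interpolation.
Variables (C : numClosedFieldType) (n : nat).

Lemma interpolation (I : finType) (x : I -> 'cV[C]_n) : injective x ->
  forall i, exists q : mpoly n C, forall j, colval q (x j) = (i == j)%:R.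
Proof.
move=> x_inj i.
have H j : exists q : mpoly n C, colval q (x i) = 1 /\ (i != j -> colval q (x j) = 0).
  have [->|ij] := eqVneq i j; first by exists 1; rewrite colval1.
  have /existsP[k xk] : [exists k, x i k 0 != x j k 0].
    rewrite -[X in is_true X]negbK negb_exists; apply/negP => /forallP xE.
    case/eqP: ij; apply: x_inj; apply/colP => k; apply/eqP.
    by have := xE k; rewrite negbK.
  exists ((x i k 0 - x j k 0)^-1 *: (mpolyX C (mnm1 k) - mpolyC n (x j k 0))).
  rewrite !colvalZ !colvalB !colvalXU !colvalC subrr mulr0.
  by rewrite mulVf// subr_eq0.
have [f fP] := choice H.
exists (\prod_(k | k != i) f k) => j; rewrite colval_prod.
have [<-|ij] := eqVneq i j; first by rewrite big1// => k _; exact: (fP k).1.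
by rewrite (bigD1 j) 1?eq_sym//= (fP j).2 ?mul0r.
Qed.

End Interpolation.

(** * The quotient map and the coordinates over the invariants *)

Section InvariantTheory.
Variables (C : numClosedFieldType) (n : nat).
Variables (gT : finGroupType) (G : {group gT}) (rG : mx_representation C G n).
Variable theta : n.-tuple (mpoly n C).
Variable p : 'I_#|G| -> mpoly n C.
Implicit Types (q r : mpoly n C) (z w : 'cV[C]_n).

Local Notation d := #|G|.

Hypothesis rG_faithful : mx_faithful rG.
Hypothesis theta_inv : forall i, invariant rG (tnth theta i).
Hypothesis theta_ind : forall q, comp_mpoly theta q = 0 -> q = 0.
Hypothesis theta_gen : forall q, invariant rG q -> exists r, q = comp_mpoly theta r.
Hypothesis p_span : forall q, exists2 c : 'I_d -> mpoly n C,
  (forall k, invariant rG (c k)) & q = \sum_(k < d) c k * p k.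
Hypothesis p_free : forall c : 'I_d -> mpoly n C,
  (forall k, invariant rG (c k)) -> \sum_(k < d) c k * p k = 0 -> forall k, c k = 0.

Definition quotient_map z : 'cV[C]_n := \col_i colval (tnth theta i) z.

Lemma colval_comp r z : colval (comp_mpoly theta r) z = colval r (quotient_map z).
Proof. by rewrite /colval comp_mpoly_meval; apply: meval_eq => i; rewrite mxE. Qed.

Lemma quotient_map_inv g z : g \in G -> quotient_map (rG g *m z) = quotient_map z.
Proof. by move=> gG; apply/colP => i; rewrite !mxE theta_inv. Qed.

Lemma invariant_comp r : invariant rG (comp_mpoly theta r).
Proof. by move=> g gG z; rewrite !colval_comp quotient_map_inv. Qed.

Lemma coords_exist q :
  exists r : 'I_d -> mpoly n C, q = \sum_(k < d) comp_mpoly theta (r k) * p k.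
Proof.
have [c cI qE] := p_span q; have [r rE] := choice (fun k => theta_gen (cI k)).
by exists r; rewrite qE; apply: eq_bigr => k _; rewrite rE.
Qed.

Definition coords q : 'I_d -> mpoly n C := projT1 (cid (coords_exist q)).

Lemma coordsE q : q = \sum_(k < d) comp_mpoly theta (coords q k) * p k.
Proof. exact: projT2 (cid (coords_exist q)). Qed.

Lemma coords_unique q (r : 'I_d -> mpoly n C) :
  q = \sum_(k < d) comp_mpoly theta (r k) * p k -> coords q =1 r.
Proof.
move=> qE k; apply/eqP; rewrite -subr_eq0; apply/eqP/theta_ind.
apply: (p_free (c := fun k => comp_mpoly theta (coords q k - r k))) => [j|].
  exact: invariant_comp.
under eq_bigr do rewrite comp_mpolyB mulrBl.
by rewrite sumrB -qE -coordsE subrr.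
Qed.

Lemma coordsD q1 q2 k : coords (q1 + q2) k = coords q1 k + coords q2 k.
Proof.
apply: (@coords_unique _ (fun k => coords q1 k + coords q2 k)).
rewrite [in LHS](coordsE q1) [in LHS](coordsE q2) -big_split.
by apply: eq_bigr => j _; rewrite comp_mpolyD mulrDl.
Qed.

Lemma coordsM r q k : coords (comp_mpoly theta r * q) k = r * coords q k.
Proof.
apply: (@coords_unique _ (fun k => r * coords q k)).
rewrite [in LHS](coordsE q) mulr_sumr; apply: eq_bigr => j _.
by rewrite rmorphM mulrA.
Qed.

Lemma coordsZ c q k : coords (c *: q) k = c *: coords q k.
Proof. by rewrite -!mul_mpolyC -coordsM comp_mpolyC. Qed.

Lemma coords_sum (I : Type) (s : seq I) (F : I -> mpoly n C) k :
  coords (\sum_(i <- s) F i) k = \sum_(i <- s) coords (F i) k.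
Proof.
elim: s => [|i s IH]; last by rewrite !big_cons coordsD IH.
by rewrite !big_nil -[0 in LHS](scale0r 0) coordsZ scale0r.
Qed.

Lemma coords_p j k : coords (p j) k = (j == k)%:R.
Proof.
apply: (@coords_unique _ (fun k => (j == k)%:R)).
rewrite (bigD1 j)//= eqxx rmorph1 mul1r big1 ?addr0// => i ij.
by rewrite eq_sym (negbTE ij) rmorph0 mul0r.
Qed.

Lemma colval_coords q z :
  colval q z = \sum_(k < d) colval (coords q k) (quotient_map z) * colval (p k) z.
Proof.
rewrite {1}(coordsE q) colval_sum; apply: eq_bigr => k _.
by rewrite colvalM colval_comp.
Qed.

(** Multiplication by [q] on the fibre algebra of the quotient map at [w], which
    has the [p k] as a basis. *)
Definition fibre_mx w q : 'M[C]_d := \matrix_(j, k) colval (coords (q * p j) k) w.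

Lemma fibre_mxD w q1 q2 : fibre_mx w (q1 + q2) = fibre_mx w q1 + fibre_mx w q2.
Proof. by apply/matrixP => j k; rewrite !mxE mulrDl coordsD colvalD. Qed.

Lemma fibre_mxM w q1 q2 : fibre_mx w (q1 * q2) = fibre_mx w q1 *m fibre_mx w q2.
Proof.
apply/matrixP => j k; rewrite !mxE (mulrC q1) -mulrA (coordsE (q1 * p j)) mulr_sumr.
rewrite coords_sum colval_sum; apply: eq_bigr => i _.
by rewrite mulrCA coordsM colvalM !mxE.
Qed.

Lemma fibre_mx_comp w r : fibre_mx w (comp_mpoly theta r) = (colval r w)%:M.
Proof.
apply/matrixP => j k; rewrite !mxE coordsM colvalM coords_p.
by case: eqP => _; rewrite ?colval1 ?colval0 ?mulr1 ?mulr0.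
Qed.

(** The fibre algebra is non zero, so the commuting multiplications by the
    coordinates have a common eigenvector; its eigenvalues are the coordinates
    of a point of the fibre. *)
Lemma quotient_map_surj w : exists z, quotient_map z = w.
Proof.
pose X i : mpoly n C := mpolyX C (mnm1 i).
have [v v0 /allP vX] : exists2 v : 'rV_d, v != 0 &
    all (fun A => stablemx v A) [seq fibre_mx w (X i) | i <- enum 'I_n].
  apply: common_eigenvector; first exact: cardG_gt0.
  move=> _ _ /mapP[i _ ->] /mapP[j _ ->].
  by rewrite /comm_mx -!fibre_mxM mulrC.
have /choice[a aE] i : exists a, v *m fibre_mx w (X i) = a *: v.
  by apply/sub_rVP; apply: vX; apply: map_f; rewrite mem_enum.
pose z : 'cV[C]_n := \col_i a i.
have vM q : v *m fibre_mx w q = colval q z *: v.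
  elim/mpoly_ring_ind: q => [c|i|q1 q2 H1 H2|q1 q2 H1 H2].
  - by rewrite -(comp_mpolyC c theta) fibre_mx_comp mul_mx_scalar colval_comp !colvalC.
  - by rewrite aE colvalXU mxE.
  - by rewrite fibre_mxD mulmxDr H1 H2 colvalD scalerDl.
  - by rewrite fibre_mxM mulmxA H1 -scalemxAl H2 scalerA colvalM.
exists z; apply/colP => i; rewrite mxE.
have : (colval (tnth theta i) z - w i 0) *: v == 0.
  rewrite scalerBl subr_eq0 -vM; have -> : tnth theta i = comp_mpoly theta (X i).
    by rewrite comp_mpolyXU (tnth_nth 0).
  by rewrite fibre_mx_comp mul_mx_scalar colvalXU.
by rewrite scaler_eq0 (negbTE v0) orbF subr_eq0 => /eqP.
Qed.

(** The norms over [G] of the forms [moment_form s (x - z0)] are polynomials in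
    the invariants vanishing at [z0]; near [quotient_map z0] they are small, so
    a point of the fibre has, for each [s], a conjugate at which that form is
    small, and hence a conjugate close to [z0]. *)
Lemma quotient_map_open z0 (e : C) : 0 < e -> exists2 b, 0 < b &
  forall w, `|w - quotient_map z0| < b -> exists2 z, `|z - z0| < e & quotient_map z = w.
Proof.
move=> e0; have [K K0 KP] := small_moment_forms C n gT.
pose c := e / (K + K); have c0 : 0 < c by rewrite divr_gt0 ?addr_gt0.
pose L (s : nat) : mpoly n C :=
  \sum_(i < n) s%:R ^+ i *: (mpolyX C (mnm1 i) - mpolyC n (z0 i 0)).
have LE s z : colval (L s) z = moment_form s (z - z0).
  rewrite colval_sum; apply: eq_bigr => i _.
  by rewrite colvalZ colvalB colvalXU colvalC !mxE.
have /choice[r rE] s := theta_gen (invariant_norm rG (L s)).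
have r0 s : colval (r s) (quotient_map z0) = 0.
  rewrite -colval_comp -rE colval_prod (bigD1 1%g)//= colval_translate.
  rewrite repr_mx1 mul1mx LE subrr /moment_form big1 ?mul0r// => i _.
  by rewrite mxE mulr0.
pose m := (n * #|gT|).+1.
have [b b0 bP] : exists2 b : C, 0 < b & forall (s : 'I_m) w,
    `|w - quotient_map z0| < b -> `|colval (r s) w| < c ^+ d.
  have cd0 : 0 < c ^+ d by rewrite exprn_gt0.
  suff H k : exists2 b : C, 0 < b & forall s w, (s < k)%N ->
      `|w - quotient_map z0| < b -> `|colval (r s) w| < c ^+ d.
    by have [b b0 bP] := H m; exists b => // s w; exact: bP.
  elim: k => [|k [b b0 bP]]; first by exists 1.
  have [b1 b10 b1P] := colval_near (r k) (quotient_map z0) cd0.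
  have [b2 [b20 b2b b2b1]] := pos_lower_bound b0 b10.
  exists b2 => // s w; rewrite ltnS leq_eqVlt => /orP[/eqP ->|sk] wb.
    by have := b1P w (lt_le_trans wb b2b1); rewrite r0 subr0.
  by apply: bP => //; exact: lt_le_trans b2b.
exists b => // w wb; have [z zw] := quotient_map_surj w.
have [||g gG zg] := KP (mem G) (fun g => rG g *m z - z0) c; first exact: ltW.
  move=> s; apply: contrapT => H.
  have {}H g : g \in G -> c <= `|moment_form s (rG g *m z - z0)|.
    move=> gG; have [//|cg] := real_leP (gtr0_real c0)
      (normr_real (moment_form s (rG g *m z - z0))).
    by case: H; exists g; rewrite // ltW.
  have le_c : \prod_(g in G) c <= \prod_(g in G) `|colval (translate rG g (L s)) z|.
    by apply: ler_prod => g gG; rewrite ltW//= colval_translate LE H.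
  have := bP s w wb; rewrite -zw -colval_comp -rE colval_prod normr_prod -prodr_const.
  by move=> /(le_lt_trans le_c); rewrite ltxx.
exists (rG g *m z); last by rewrite quotient_map_inv.
apply: le_lt_trans zg _; rewrite /c mulrA ltr_pdivrMr ?addr_gt0//.
by rewrite mulrC mulrDr ltrDl mulr_gt0.
Qed.

Definition orbit_point (i : 'I_d) z : 'cV[C]_n := rG (enum_val i) *m z.

Definition orbit_mx : 'M[mpoly n C]_d :=
  \matrix_(i, k) translate rG (enum_val i) (p k).

Definition orbit_det : mpoly n C := \det orbit_mx.

Lemma enum_valG (i : 'I_d) : enum_val i \in G.
Proof. exact: enum_valP. Qed.

Lemma colval_orbit_point q i z : colval q (orbit_point i z) =
  \sum_(k < d) colval (coords q k) (quotient_map z) * colval (p k) (orbit_point i z).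
Proof. by rewrite colval_coords quotient_map_inv// enum_valG. Qed.

(** The coefficients [F] are determined by the values [b] on the orbit of [z]
    through a linear system whose determinant is [orbit_det]. *)
Lemma orbit_cramer z (F b : 'I_d -> C) :
  (forall i, \sum_(k < d) colval (p k) (orbit_point i z) * F k = b i) ->
  forall k, colval orbit_det z * F k = \sum_i colval (\adj orbit_mx k i) z * b i.
Proof.
move=> Fb k; pose ev := map_mx (meval (fun i => z i 0)).
have bE : \col_i b i = ev _ _ orbit_mx *m \col_k F k.
  apply/colP => i; rewrite !mxE -Fb; apply: eq_bigr => j _; rewrite !mxE.
  by rewrite -[meval _ _]/(colval _ z) colval_translate.
have : ev _ _ (\adj orbit_mx) *m \col_i b i = (colval orbit_det z)%:M *m \col_k F k.
  by rewrite bE mulmxA -map_mxM mul_adj_mx map_scalar_mx.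
move/matrixP/(_ k 0); rewrite mul_scalar_mx !mxE => <-.
by apply: eq_bigr => i _; rewrite !mxE.
Qed.

(** On a free orbit all functions are restrictions of polynomials, hence
    combinations of the [p k]; there the square matrix of their values is
    invertible. *)
Lemma orbit_det_neq0 : exists z, colval orbit_det z != 0.
Proof.
have [z z_free] := free_orbit_point rG_faithful.
have x_inj : injective (orbit_point^~ z).
  move=> i j ij; apply: enum_val_inj; apply/eqP; rewrite eq_mulVg1; apply/eqP.
  apply: z_free; first by rewrite groupM ?groupV ?enum_valG.
  rewrite repr_mxM ?groupV ?enum_valG// -mulmxA -[rG (enum_val j) *m z]ij.
  by rewrite repr_mulKV ?enum_valG.
have /choice[q qE] := interpolation x_inj.
pose A := map_mx (meval (fun i => z i 0)) orbit_mx.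
pose U : 'M[C]_d := \matrix_(k, i) colval (coords (q i) k) (quotient_map z).
have AU : A *m U = 1%:M.
  apply/matrixP => j i; rewrite !mxE eq_sym -qE colval_orbit_point.
  apply: eq_bigr => k _; rewrite !mxE mulrC.
  by rewrite -[meval _ _]/(colval _ z) colval_translate.
exists z; have [uA _] := mulmx1_unit AU.
by move: uA; rewrite unitmxE det_map_mx unitfE.
Qed.

(** The line joins [z0] to a point where [orbit_det] does not vanish. *)
Lemma orbit_det_line z0 (e : C) : 0 < e -> exists (v : 'cV[C]_n) (r c : C),
  [/\ 0 < r, 0 < c, r * `|v| < e &
    forall x : C, `|x| = r -> c <= `|colval orbit_det (z0 + x *: v)|].
Proof.
move=> e0; have [z1 z1P] := orbit_det_neq0; pose v := z1 - z0.
have [P [PE _]] := colval_line orbit_det z0 v.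
have P0 : P != 0.
  apply: contra_neq z1P => P0.
  by have := PE 1; rewrite P0 horner0 scale1r addrC subrK.
have v0 : 0 < `|v| + 1 by rewrite ltr_wpDl.
have [r [c [r0 re c0 Pc]]] := small_circle_away P0 (divr_gt0 e0 v0).
exists v, r, c; split=> // [|x xr]; last by rewrite -PE Pc.
rewrite (@lt_le_trans _ _ (r * (`|v| + 1)))//; first by rewrite ltr_pM2l// ltrDl.
by rewrite -ler_pdivlMr.
Qed.

Lemma orbit_det_dense z0 (e : C) : 0 < e ->
  exists2 z, `|z - z0| < e & colval orbit_det z != 0.
Proof.
move=> /(orbit_det_line z0)[v [r [c [r0 c0 rv rc]]]].
have nr : `|r| = r by rewrite ger0_norm ?ltW.
exists (z0 + r *: v); first by rewrite addrC addKr normrZ nr.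
by rewrite -normr_gt0 (lt_le_trans c0)// rc.
Qed.

(** Where [orbit_det] is small, Cramer's formula gives no bound on the
    coordinates; but these are polynomials along a complex line through [z], so
    that their value at [z] is bounded by their values on a small circle on
    which [orbit_det] stays away from [0]. *)
Lemma coords_bound z0 (e : C) : 0 < e -> exists b K : C,
  [/\ 0 < b, 0 <= K & forall q M,
    (forall z i, `|z - z0| < e -> `|colval q (orbit_point i z)| <= M) ->
    forall z k, `|z - z0| < b -> `|colval (coords q k) (quotient_map z)| <= K * M].
Proof.
move=> e0; have e20 : 0 < e / 2 by rewrite divr_gt0.
have [v [r [c [r0 c0 rv rc]]]] := orbit_det_line z0 e20.
have B0 : 0 <= `|z0| + e by rewrite addr_ge0// ltW.
have inB z : `|z - z0| < e -> `|z| <= `|z0| + e.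
  move=> /ltW ze; rewrite -(subrK z0 z) addrC (le_trans (ler_normD _ _))//.
  by rewrite lerD2l.
have [L L0 LP] := colval_lipschitz orbit_det B0.
have [b0 [b00 b0e b0c]] :=
  pos_lower_bound e20 (divr_gt0 c0 (ltr_wpDl (addr_ge0 L0 L0) ltr01)).
have /choice[N NP] ki : exists N : C, 0 <= N /\
    forall z, `|z| <= `|z0| + e -> `|colval (\adj orbit_mx ki.1 ki.2) z| <= N.
  have [N N0 NP] := colval_lipschitz (\adj orbit_mx ki.1 ki.2) B0.
  by exists N; split=> // z zB; have [] := NP z z zB zB.
pose S := \sum_ki N ki.
have S0 : 0 <= S by apply: sumr_ge0 => ki _; have [] := NP ki.
exists b0, (2 / c * S); split=> [//||q M qM z k zb].
  by rewrite mulr_ge0// divr_ge0 ?ltW.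
have z0r x : `|x| = r -> `|z + x *: v - z0| < e.
  move=> xr; rewrite addrAC (le_lt_trans (ler_normD _ _))// normrZ xr.
  by rewrite [e]splitr ltrD// (lt_le_trans zb).
have c2 x : `|x| = r -> c / 2 <= `|colval orbit_det (z + x *: v)|.
  move=> xr; have z0x : `|z0 + x *: v - z0| < e.
    rewrite addrC addKr normrZ xr (lt_trans rv)// ltr_pdivrMr// mulr_natr.
    by rewrite mulr2n ltrDl.
  have [_] := LP _ _ (inB _ z0x) (inB _ (z0r x xr)).
  rewrite opprD addrACA subrr addr0 => LPx.
  have Lc : L * `|z0 - z| <= c / 2.
    rewrite distrC (le_trans (ler_wpM2l L0 (le_trans (ltW zb) b0c)))//.
    have L10 : 0 < L + L + 1 by rewrite ltr_wpDl ?addr_ge0.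
    rewrite mulrA ler_pdivrMr//.
    have -> : c / 2 * (L + L + 1) = L * c + c / 2 by field.
    by rewrite lerDl divr_ge0 ?ltW.
  have := ler_normD (colval orbit_det (z0 + x *: v) - colval orbit_det (z + x *: v))
    (colval orbit_det (z + x *: v)); rewrite subrK => /(le_trans (rc x xr)).
  move=> /le_trans/(_ (lerD (le_trans LPx Lc) (lexx _))).
  by rewrite [X in X <= _ -> _]splitr lerD2l.
rewrite -colval_comp; apply: (colval_center_bound (v := v) r0) => x xr.
rewrite colval_comp -[leRHS]mulrA -ler_pdivrMl ?divr_gt0// invf_div.
rewrite (@le_trans _ _ (`|colval orbit_det (z + x *: v)| *
  `|colval (coords q k) (quotient_map (z + x *: v))|))//.
  by rewrite ler_wpM2r// c2.
rewrite -normrM (@orbit_cramer (z + x *: v)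
    (fun k => colval (coords q k) (quotient_map (z + x *: v)))
    (fun i => colval q (orbit_point i (z + x *: v)))); last first.
  by move=> i; rewrite colval_orbit_point; apply: eq_bigr => j _; rewrite mulrC.
apply: le_trans (ler_norm_sum _ _ _) _.
have M0 : 0 <= M.
  by apply: le_trans (normr_ge0 _) (qM z0 (enum_rank_in (group1 G) 1%g) _); rewrite subrr normr0.
apply: (@le_trans _ _ (\sum_i N (k, i) * M)).
  apply: ler_sum => i _; rewrite normrM ler_pM//; last exact: qM (z0r x xr).
  by have [_] := NP (k, i); apply; apply: inB; exact: z0r.
rewrite -mulr_suml ler_wpM2r//.
have -> : S = \sum_j \sum_i N (j, i).
  by rewrite pair_bigA; apply: eq_bigr => -[].
rewrite [leRHS](bigD1 k)//= lerDl sumr_ge0// => j _.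
by rewrite sumr_ge0// => i _; have [] := NP (j, i).
Qed.

Lemma quotient_map_continuous : continuous quotient_map.
Proof.
move=> z; apply: continuous_col => i.
have -> : (fun x => quotient_map x i 0) = colval (tnth theta i).
  by apply/funext => x; rewrite mxE.
exact: colval_continuous.
Qed.

(** By invariance the coefficients satisfy the linear system of the whole orbit,
    so they vanish where [orbit_det] does not, and by continuity everywhere. *)
Lemma continuous_coords_eq0 (Omega : set 'cV[C]_n) (F : 'cV[C]_n -> 'cV[C]_d) z0 :
  open Omega -> (forall g z, g \in G -> Omega z -> Omega (rG g *m z)) ->
  Omega z0 -> {for quotient_map z0, continuous F} ->
  (forall z, Omega z -> \sum_(k < d) colval (p k) z * F (quotient_map z) k 0 = 0) ->
  F (quotient_map z0) = 0.
Proof.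
move=> Oopen Oact Oz0 Fcont F0.
have Fth_cont : {for z0, continuous (F \o quotient_map)}.
  by apply: continuous_comp Fcont; exact: quotient_map_continuous.
(* [F \o quotient_map] vanishes at points arbitrarily close to [z0]. *)
apply: contrapT => /eqP Fn0; have e0 : 0 < `|F (quotient_map z0)| by rewrite normr_gt0.
have near_F := proj1 (@cvgrPdistC_lt _ _ _ (nbhs z0) (nbhs_filter z0) _ _) Fth_cont _ e0.
have [b0 b00 b0P] := proj1 (@nbhs_normP C 'cV[C]_n z0 _) near_F.
have /(@nbhs_normP C 'cV[C]_n z0)[b1 b10 b1P] : nbhs z0 Omega by exact: open_nbhs_nbhs.
have [b [bb0 bb0' bb1]] := pos_lower_bound b00 b10.
have [z zb dz] := orbit_det_dense z0 bb0.
have Oz : Omega z by apply: b1P; rewrite /= distrC (lt_le_trans zb).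
have Fz0 : F (quotient_map z) = 0.
  apply/colP => k; rewrite mxE; apply: (mulfI dz); rewrite mulr0.
  rewrite (@orbit_cramer z (fun k => F (quotient_map z) k 0) (fun=> 0)).
    by rewrite big1// => i _; rewrite mulr0.
  move=> i; have gG := enum_valG i; have := F0 _ (Oact _ _ gG Oz).
  by rewrite quotient_map_inv.
have := b0P z; rewrite /= distrC => /(_ (lt_le_trans zb bb0')).
by rewrite Fz0 sub0r normrN ltxx.
Qed.

End InvariantTheory.

(** * Real parts and moduli of complex numbers *)

Section RealParts.
Variable R : realType.
Local Notation C := (Cplx R).
Implicit Types (a b : C) (x y : R).

Definition creal x : C := (x +i* 0)%C.
Definition cre a : R := complex.Re a.
Definition cabs a : R := cre `|a|.

Lemma creK x : cre (creal x) = x. Proof. by []. Qed.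
Lemma creD a b : cre (a + b) = cre a + cre b. Proof. by case: a b => [? ?] [? ?]. Qed.
Lemma creN a : cre (- a) = - cre a. Proof. by case: a. Qed.
Lemma creJ a : cre a^* = cre a. Proof. by case: a. Qed.
Lemma creM x a : cre (creal x * a) = x * cre a.
Proof. by case: a => [? ?] /=; rewrite /cre /= mul0r subr0. Qed.

Lemma crealD x y : creal (x + y) = creal x + creal y.
Proof. exact: (rmorphD (real_complex R)). Qed.
Lemma crealM x y : creal (x * y) = creal x * creal y.
Proof. exact: (rmorphM (real_complex R)). Qed.
Lemma crealX x m : creal (x ^+ m) = creal x ^+ m.
Proof. exact: (rmorphXn (real_complex R)). Qed.
Lemma creal2 x : creal (2%:R * x) = 2%:R * creal x.
Proof. by rewrite crealM; congr (_ * _); exact: (rmorph_nat (real_complex R) 2). Qed.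
Lemma creal0 : creal 0 = 0. Proof. by []. Qed.
Lemma creal1 : creal 1 = 1. Proof. by []. Qed.
Lemma crealN x : creal (- x) = - creal x.
Proof. exact: (rmorphN (real_complex R)). Qed.
Lemma crealJ x : (creal x)^* = creal x.
Proof. exact: conjc_real. Qed.
Lemma creal_le x y : (creal x <= creal y) = (x <= y). Proof. exact: lecR. Qed.
Lemma creal_lt x y : (creal x < creal y) = (x < y). Proof. exact: ltcR. Qed.

Lemma creal_natV j : creal (j.+1%:R^-1) = j.+1%:R^-1 :> C.
Proof. by have := fmorphV (real_complex R) j.+1%:R; rewrite rmorph_nat. Qed.

Lemma cre_eq a : 0 <= a -> creal (cre a) = a.
Proof. by move=> /ger0_real; exact: RRe_real. Qed.

Lemma cre_ge0 a : 0 <= a -> 0 <= cre a.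
Proof. by move=> a0; rewrite -creal_le cre_eq. Qed.

Lemma cre_gt0 a : 0 < a -> 0 < cre a.
Proof. by move=> a0; rewrite -creal_lt cre_eq// ltW. Qed.

Lemma cabsE a : creal (cabs a) = `|a|. Proof. by rewrite cre_eq. Qed.

Lemma cabs_le a x : (`|a| <= creal x) = (cabs a <= x).
Proof. by rewrite -cabsE creal_le. Qed.

Lemma cabs_ge0 a : 0 <= cabs a. Proof. exact: cre_ge0. Qed.
Lemma cabs0 : cabs 0 = 0. Proof. by rewrite /cabs normr0 -creal0 creK. Qed.
Lemma cabs1 : cabs 1 = 1. Proof. by rewrite /cabs normr1 -creal1 creK. Qed.
Lemma cabsN a : cabs (- a) = cabs a. Proof. by rewrite /cabs normrN. Qed.
Lemma cabsJ a : cabs a^* = cabs a. Proof. by rewrite /cabs norm_conjC. Qed.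
Lemma cabs_creal x : 0 <= x -> cabs (creal x) = x.
Proof. by move=> x0; rewrite /cabs ger0_norm// -creal0 creal_le. Qed.
Lemma cabs_crealN x : cabs (creal x) = `|x|.
Proof.
case: (ger0P x) => x0; first exact: cabs_creal.
by rewrite -cabsN -crealN cabs_creal// oppr_ge0 ltW.
Qed.

Lemma cabsD a b : cabs (a + b) <= cabs a + cabs b.
Proof. by rewrite -creal_le crealD !cabsE ler_normD. Qed.

Lemma cre_le_cabs a : cre a <= cabs a.
Proof.
case: a => x y; rewrite /cabs normc_def /cre /=.
by rewrite (le_trans (ler_norm x))// -sqrtr_sqr ler_wsqrtr// lerDl sqr_ge0.
Qed.

Lemma cabs_sqr a : creal (cabs a ^+ 2) = a * a^*.
Proof. by rewrite expr2 crealM cabsE -expr2 normCK. Qed.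

Lemma cre_eq0 a : (forall b, cre (b * a) = 0) -> a = 0.
Proof.
move=> H; apply/eqP; rewrite -normr_eq0 -cabsE.
have := H a^*; rewrite mulrC -cabs_sqr creK => /eqP.
by rewrite sqrf_eq0 => /eqP ->.
Qed.

End RealParts.

(** * Hilbert spaces *)

Lemma quadratic_discriminant_le (F : realFieldType) (A B D : F) : 0 <= D ->
  (forall t, 0 <= A + 2 * (t * B) + t ^+ 2 * D) -> B ^+ 2 <= A * D.
Proof.
move=> D0 H; have A0 : 0 <= A by have := H 0; rewrite expr0n /= !mul0r mulr0 !addr0.
have [D00|Dn0] := eqVneq D 0.
  have [->|B0] := eqVneq B 0; first by rewrite expr0n /= mulr_ge0.
  by have := H (- (A + 1) / B); rewrite D00 mulr0 divfK//; lra.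
have {}D0 : 0 < D by rewrite lt0r Dn0.
have := H (- B / D).
have -> : A + 2 * (- B / D * B) + (- B / D) ^+ 2 * D = (A * D - B ^+ 2) / D by field.
by rewrite pmulr_lge0 ?invr_gt0// subr_ge0.
Qed.

Section HilbertTheory.
Variables (R : realType) (V : lmodType (Cplx R)).
Local Notation C := (Cplx R).
Variables (H : set V) (ip : V -> V -> C).
Hypothesis hs : hilbert_space H ip.
Implicit Types (u v w : V) (a : C).

Local Notation nrm := (hnorm ip).

Lemma hilbertD u v : H u -> H v -> H (u + v).
Proof. by move=> Hu Hv; have := hilbertP hs 1 Hu Hv; rewrite scale1r. Qed.

Lemma hilbertZ a u : H u -> H (a *: u).
Proof. by move=> Hu; have := hilbertP hs a Hu (hilbert0 hs); rewrite addr0. Qed.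

Lemma hilbertB u v : H u -> H v -> H (u - v).
Proof. by move=> Hu Hv; have := hilbertP hs (-1) Hv Hu; rewrite scaleN1r addrC. Qed.

Lemma ipD u v w : H u -> H v -> H w -> ip (u + v) w = ip u w + ip v w.
Proof. by move=> Hu Hv Hw; have := hilbert_linear hs 1 Hu Hv Hw; rewrite scale1r mul1r. Qed.

Lemma ip0l w : H w -> ip 0 w = 0.
Proof.
move=> Hw; have := ipD (hilbert0 hs) (hilbert0 hs) Hw; rewrite addr0 => /eqP.
by rewrite -subr_eq0 opprD addrA subrr add0r oppr_eq0 => /eqP.
Qed.

Lemma ipZ a u w : H u -> H w -> ip (a *: u) w = a * ip u w.
Proof.
move=> Hu Hw; have := hilbert_linear hs a Hu (hilbert0 hs) Hw.
by rewrite ip0l// !addr0.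
Qed.

Lemma ipB u v w : H u -> H v -> H w -> ip (u - v) w = ip u w - ip v w.
Proof.
move=> Hu Hv Hw; rewrite -scaleN1r ipD//; last exact: hilbertZ.
by rewrite ipZ// mulN1r.
Qed.

Lemma ipDr u v w : H u -> H v -> H w -> ip w (u + v) = ip w u + ip w v.
Proof.
move=> Hu Hv Hw; rewrite (hilbert_sym hs (hilbertD Hu Hv) Hw) ipD// rmorphD /=.
by rewrite -(hilbert_sym hs Hu Hw) -(hilbert_sym hs Hv Hw).
Qed.

Lemma ipZr a u w : H u -> H w -> ip w (a *: u) = a^* * ip w u.
Proof.
move=> Hu Hw; rewrite (hilbert_sym hs (hilbertZ a Hu) Hw) ipZ// rmorphM /=.
by rewrite -(hilbert_sym hs Hu Hw).
Qed.

Lemma ip_ge0 u : H u -> 0 <= ip u u.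
Proof.
move=> Hu; have [->|u0] := eqVneq u 0; last exact/ltW/(hilbert_pos hs).
by rewrite ip0l//; exact: (hilbert0 hs).
Qed.

Lemma nrm_sqr u : H u -> nrm u ^+ 2 = cre (ip u u).
Proof. by move=> Hu; rewrite /hnorm sqr_sqrtr// cre_ge0// ip_ge0. Qed.

Lemma nrm_ge0 u : 0 <= nrm u. Proof. exact: sqrtr_ge0. Qed.

Lemma nrm0 : nrm 0 = 0.
Proof. by rewrite /hnorm ip0l ?sqrtr0//; exact: (hilbert0 hs). Qed.

Lemma nrmZ a u : H u -> nrm (a *: u) = cabs a * nrm u.
Proof.
move=> Hu; have Hau := hilbertZ a Hu.
apply/eqP; rewrite -(@eqrXn2 _ 2) ?mulr_ge0 ?nrm_ge0 ?cabs_ge0//; apply/eqP.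
by rewrite exprMn !nrm_sqr// ipZ// ipZr// mulrA -cabs_sqr creM.
Qed.

Lemma cre_ipC u v : H u -> H v -> cre (ip u v) = cre (ip v u).
Proof. by move=> Hu Hv; rewrite (hilbert_sym hs Hv Hu) creJ. Qed.

Lemma nrmD_sqr u v : H u -> H v ->
  nrm (u + v) ^+ 2 = nrm u ^+ 2 + 2 * cre (ip u v) + nrm v ^+ 2.
Proof.
move=> Hu Hv; rewrite !nrm_sqr//; last exact: hilbertD.
rewrite ipD ?ipDr//; try exact: hilbertD.
by rewrite !creD (cre_ipC Hv Hu); ring.
Qed.

Lemma cre_ip_le u v : H u -> H v -> cre (ip u v) <= nrm u * nrm v.
Proof.
move=> Hu Hv.
have H2 t : 0 <= nrm u ^+ 2 + 2 * (t * cre (ip u v)) + t ^+ 2 * nrm v ^+ 2.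
  have Htv := hilbertZ (creal t) Hv.
  have := nrmD_sqr Hu Htv; rewrite ipZr// crealJ creM nrmZ// cabs_crealN.
  by rewrite exprMn real_normK ?num_real// => <-; exact: sqr_ge0.
have := quadratic_discriminant_le (sqr_ge0 (nrm v)) H2; rewrite -exprMn => H3.
rewrite leNgt; apply/negP => uv; have uv0 := mulr_ge0 (nrm_ge0 u) (nrm_ge0 v).
move: H3; rewrite ler_sqr ?nnegrE//; last by rewrite ltW// (le_lt_trans uv0).
by move/(lt_le_trans uv); rewrite ltxx.
Qed.

Lemma ipBr u v w : H u -> H v -> H w -> ip w (u - v) = ip w u - ip w v.
Proof.
move=> Hu Hv Hw; rewrite -scaleN1r ipDr//; last exact: hilbertZ.
by rewrite ipZr// rmorphN1 mulN1r.
Qed.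

Lemma hilbert_lincomb (I : finType) (a : I -> C) (u : I -> V) :
  (forall i, H (u i)) -> H (\sum_i a i *: u i).
Proof.
move=> Hu; elim/big_ind : _ => [|x y|i _]; first exact: (hilbert0 hs).
  exact: hilbertD.
exact: hilbertZ.
Qed.

Lemma ip_lincombl (I : finType) (a : I -> C) (u : I -> V) f :
  (forall i, H (u i)) -> H f ->
  ip (\sum_i a i *: u i) f = \sum_i a i * ip (u i) f.
Proof.
move=> Hu Hf; suff [] : H (\sum_i a i *: u i) /\
  ip (\sum_i a i *: u i) f = \sum_i a i * ip (u i) f by [].
elim/big_rec2 : _ => [|i x y _ [Hy <-]].
  by split; [exact: (hilbert0 hs)|rewrite ip0l].
have Hau := hilbertZ (a i) (Hu i).
by split; [exact: hilbertD|rewrite ipD// ipZ].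
Qed.

Lemma ip_lincomb (I : finType) (a : I -> C) (u : I -> V) f :
  (forall i, H (u i)) -> H f ->
  ip f (\sum_i a i *: u i) = \sum_i (a i)^* * ip f (u i).
Proof.
move=> Hu Hf; suff [] : H (\sum_i a i *: u i) /\
  ip f (\sum_i a i *: u i) = \sum_i (a i)^* * ip f (u i) by [].
elim/big_rec2 : _ => [|i x y _ [Hy <-]].
  split; first exact: (hilbert0 hs).
  by rewrite (hilbert_sym hs (hilbert0 hs) Hf) ip0l// rmorph0.
have Hau := hilbertZ (a i) (Hu i).
by split; [exact: hilbertD|rewrite ipDr// ipZr].
Qed.

Lemma ip_lincombC (I : finType) (a : I -> C) (u : I -> V) f :
  (forall i, H (u i)) -> H f ->
  ip f (\sum_i (a i)^* *: u i) = \sum_i a i * ip f (u i).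
Proof.
by move=> Hu Hf; rewrite ip_lincomb//; apply: eq_bigr => i _; rewrite conjCK.
Qed.

Lemma cauchy_schwarz u v : H u -> H v -> cabs (ip u v) <= nrm u * nrm v.
Proof.
move=> Hu Hv; have [a0|a0] := eqVneq (cabs (ip u v)) 0.
  by rewrite a0 mulr_ge0 ?nrm_ge0.
have {}a0 : 0 < cabs (ip u v) by rewrite lt0r a0 cabs_ge0.
have Hau := hilbertZ (ip u v)^* Hu.
have := cre_ip_le Hau Hv; rewrite ipZ// nrmZ// cabsJ mulrC -cabs_sqr creK -mulrA.
by rewrite expr2 ler_pM2l.
Qed.

Lemma nrmD u v : H u -> H v -> nrm (u + v) <= nrm u + nrm v.
Proof.
move=> Hu Hv; rewrite -ler_sqr ?nnegrE ?addr_ge0 ?nrm_ge0//.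
rewrite nrmD_sqr// sqrrD; have := cre_ip_le Hu Hv; lra.
Qed.

Lemma nrmBC u v : H u -> H v -> nrm (u - v) = nrm (v - u).
Proof.
move=> Hu Hv; rewrite -(opprB v u) -(scaleN1r (v - u)) nrmZ; last exact: hilbertB.
by rewrite cabsN cabs1 mul1r.
Qed.

Lemma nrm_triangle u v w : H u -> H v -> H w -> nrm (u - w) <= nrm (u - v) + nrm (v - w).
Proof.
move=> Hu Hv Hw; have -> : u - w = (u - v) + (v - w) by rewrite addrA subrK.
by apply: nrmD; apply: hilbertB.
Qed.

(** ** Functionals on a dense subspace *)

Variable P : set V.
Hypothesis PH : P `<=` H.
Hypothesis PD : forall u v, P u -> P v -> P (u + v).
Hypothesis PZ : forall a u, P u -> P (a *: u).
Hypothesis P_dense : forall f, H f -> forall e : R, 0 < e ->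
  exists2 q, P q & nrm (f - q) < e.

Lemma functional_bound_dense u (M : R) : H u -> 0 <= M ->
  (forall q, P q -> cabs (ip q u) <= M * nrm q) ->
  forall f, H f -> cabs (ip f u) <= M * nrm f.
Proof.
move=> Hu M0 uM f Hf; apply/ler_addgt0Pr => e e0.
have s0 : 0 < nrm u + M + 1 by have := nrm_ge0 u; lra.
have [q Pq fq] := P_dense Hf (divr_gt0 e0 s0); have Hq := PH Pq.
have -> : ip f u = ip (f - q) u + ip q u by rewrite ipB// subrK.
apply: le_trans (cabsD _ _) _.
have := cauchy_schwarz (hilbertB Hf Hq) Hu; have := uM q Pq.
have : nrm q <= nrm f + nrm (f - q).
  rewrite nrmBC//; have := nrmD Hf (hilbertB Hq Hf); by rewrite addrC subrK.
have : nrm (f - q) * (nrm u + M + 1) <= e by rewrite -ler_pdivlMr// ltW.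
have := nrm_ge0 (f - q); have := nrm_ge0 u; nra.
Qed.

Lemma eq_functional_dense u v : H u -> H v ->
  (forall q, P q -> ip q u = ip q v) -> forall f, H f -> ip f u = ip f v.
Proof.
move=> Hu Hv uv f Hf; apply/eqP; rewrite -subr_eq0 -ipBr// -normr_le0 -creal0 cabs_le.
rewrite -(mul0r (nrm f)); apply: functional_bound_dense => // [|q Pq].
  exact: hilbertB.
by rewrite ipBr// ?uv// ?subrr ?cabs0 ?mul0r//; exact: PH.
Qed.

(** Completeness in the form of a rate of convergence inherited by the limit. *)
Lemma hilbert_limit (x : nat -> V) (e : nat -> R) : (forall i, H (x i)) ->
  (forall d, 0 < d -> exists N, forall i, (N <= i)%N -> e i < d) ->
  (forall i j, (i <= j)%N -> nrm (x j - x i) <= e i) ->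
  exists2 f, H f & forall i, nrm (x i - f) <= e i.
Proof.
move=> Hx e0 xe.
have [|f Hf xf] := hilbert_complete hs Hx.
  move=> d d0; have [N NP] := e0 d d0; exists N => i j Ni Nj.
  have [ij|/ltnW ji] := leqP i j.
    by rewrite nrmBC// (le_lt_trans (xe _ _ ij))// NP.
  by rewrite (le_lt_trans (xe _ _ ji))// NP.
exists f => // i; apply/ler_addgt0Pr => d d0.
move/cvgrPdist_lt: xf => /(_ d d0)[N _ NP].
have := NP (N + i)%N (leq_addr _ _); rewrite /= sub0r normrN ger0_norm ?nrm_ge0// => xf.
apply: le_trans (nrm_triangle (Hx i) (Hx (N + i)%N) Hf) _.
by rewrite lerD ?(ltW xf)// nrmBC// xe// leq_addl.
Qed.

(** The functional [l] is represented by the minimizer of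
    [u |-> |u|^2 - 2 Re (l u)]: by the parallelogram law a minimizing sequence
    in [P] is a Cauchy sequence, and its limit is the minimizer. *)
Lemma riesz_dense (l : V -> C) (M : R) :
  (forall u v, P u -> P v -> l (u + v) = l u + l v) ->
  (forall a u, P u -> l (a *: u) = a * l u) ->
  (forall u, P u -> cabs (l u) <= M * nrm u) ->
  exists2 u, H u & forall q, P q -> l q = ip q u.
Proof.
move=> lD lZ lM; pose J u : R := nrm u ^+ 2 - 2 * cre (l u).
have J_lb u : P u -> - (M ^+ 2) <= J u.
  move=> Pu; have := lM u Pu; have := cre_le_cabs (l u); rewrite /J.
  by have := sqr_ge0 (nrm u - M); rewrite sqrrB; nra.
have P0 : P 0.
  have [q Pq _] := P_dense (hilbert0 hs) ltr01.
  by rewrite -(scale0r q); exact: PZ.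
pose I := inf (J @` P).
have J_inf : has_inf (J @` P).
  split; first by exists (J 0), 0.
  by exists (- (M ^+ 2)) => _ [u Pu <-]; exact: J_lb.
have IJ u : P u -> I <= J u by move=> Pu; apply: ge_inf (J_inf.2) _ _; exists u.
have eps_gt0 j : 0 < (j.+1%:R^-1 : R) by rewrite invr_gt0.
have /choice[x xP] j : exists u, P u /\ J u < I + j.+1%:R^-1.
  by have [_ [u Pu <-] Ju] := inf_adherent (eps_gt0 j) J_inf; exists u.
have Px j := (xP j).1; have Hx j := PH (Px j).
have x_cauchy i j : (i <= j)%N -> nrm (x j - x i) <= 2 * Num.sqrt i.+1%:R^-1.
  move=> ij; have eij : (j.+1%:R^-1 : R) <= i.+1%:R^-1 by rewrite lef_pV2 ?posrE// ler_nat.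
  (* The parallelogram law, with the lower bound [I] at the midpoint. *)
  have := IJ _ (PZ (creal 2^-1) (PD (Px i) (Px j))).
  have := xP i; have := xP j; rewrite /J => -[_ Jj] [_ Ji].
  rewrite nrmZ; last exact/hilbertD.
  rewrite cabs_creal ?invr_ge0// exprMn lZ; last exact: PD.
  rewrite creM lD// creD nrmD_sqr// => IJij.
  rewrite -ler_sqr ?nnegrE ?nrm_ge0 ?mulr_ge0 ?sqrtr_ge0//.
  rewrite exprMn [X in _ <= _ * X]sqr_sqrtr ?invr_ge0// -(scaleN1r (x i)).
  rewrite nrmD_sqr//; last exact: hilbertZ.
  rewrite nrmZ// cabsN cabs1 mul1r ipZr// rmorphN1 mulN1r creN (cre_ipC (Hx j) (Hx i)).
  move: IJij Jj Ji eij; have -> : 2^-1 ^+ 2 = 4^-1 :> R by field.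
  have -> : 2 ^+ 2 = 4 :> R by ring.
  by move: (i.+1%:R^-1) (j.+1%:R^-1) => ei ej; lra.
have sqrt_small (d : R) : 0 < d ->
    exists N, forall i, (N <= i)%N -> 2 * Num.sqrt i.+1%:R^-1 < d.
  move=> d0; exists (Num.Def.truncn (4 / d ^+ 2)) => i Ni.
  have d20 : 0 < d ^+ 2 by rewrite exprn_gt0.
  rewrite -ltr_sqr ?nnegrE ?mulr_ge0 ?sqrtr_ge0// ?ltW//.
  rewrite exprMn sqr_sqrtr ?invr_ge0// ltr_pdivrMr ?ltr0n// mulrC -ltr_pdivrMr//.
  have -> : 2 ^+ 2 = 4 :> R by ring.
  by rewrite (lt_le_trans (truncnS_gt _))// ler_nat.
have [u Hu xu] := hilbert_limit Hx sqrt_small x_cauchy.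
suff lu q : P q -> cre (l q - ip q u) = 0.
  exists u => // q Pq; apply/eqP; rewrite -subr_eq0; apply/eqP/cre_eq0 => a.
  by rewrite mulrBr -lZ// -ipZ ?lu//; [exact: PZ|exact: PH].
move=> Pq; have Hq := PH Pq; apply/eqP; rewrite -normr_le0.
apply/ler_addgt0Pr => e e0; rewrite add0r.
have s0 : 0 < 2 * (nrm q + 1) by have := nrm_ge0 q; lra.
have [N /(_ N (leqnn N)) NP] := sqrt_small _ (divr_gt0 e0 s0).
set eN := 2 * _ in NP.
have eN0 : 0 <= eN by rewrite mulr_ge0 ?sqrtr_ge0.
(* The derivative of [J] at the almost minimizing [x N] is small. *)
have : cre (ip q (x N) - l q) ^+ 2 <= N.+1%:R^-1 * nrm q ^+ 2.
  apply: quadratic_discriminant_le; first exact: sqr_ge0.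
  move=> t; have := IJ _ (PD (Px N) (PZ (creal t) Pq)); have := (xP N).2; rewrite /J.
  have Htq := hilbertZ (creal t) Hq.
  rewrite nrmD_sqr// nrmZ// ipZr// crealJ cabs_crealN exprMn real_normK ?num_real//.
  rewrite lD//; last exact: PZ.
  rewrite lZ// !creD !creM creN (cre_ipC (Hx N) Hq).
  move: (N.+1%:R^-1 : R) (nrm (x N)) (nrm q) (cre _) (cre _) (cre _) => E A B L1 L2 L3; nra.
have -> : N.+1%:R^-1 = (Num.sqrt N.+1%:R^-1 : R) ^+ 2 by rewrite sqr_sqrtr ?invr_ge0.
rewrite -exprMn -real_normK ?num_real// ler_sqr ?nnegrE ?mulr_ge0 ?sqrtr_ge0 ?nrm_ge0//.
have : `|cre (ip q (x N - u))| <= nrm q * eN.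
  rewrite (@le_trans _ _ (cabs (ip q (x N - u))))//.
    rewrite ler_norml cre_le_cabs andbT lerNl -creN -(cabsN (ip _ _)).
    exact: cre_le_cabs.
  apply: le_trans (cauchy_schwarz Hq (hilbertB (Hx N) Hu)) _.
  by rewrite ler_wpM2l ?nrm_ge0// xu.
rewrite ipBr//.
have -> : cre (l q - ip q u) = cre (ip q (x N) - ip q u) - cre (ip q (x N) - l q).
  by rewrite !creD !creN; ring.
have := ler_normB (cre (ip q (x N) - ip q u)) (cre (ip q (x N) - l q)).
have : eN * (nrm q + 1) * 2 < e.
  by rewrite -mulrA (mulrC _ 2) -ltr_pdivlMr.
have : Num.sqrt N.+1%:R^-1 * 2 = eN by rewrite mulrC.
have := nrm_ge0 q; nra.
Qed.

(** Gliding hump: at each step [f] is moved by [3 ^- j] in the direction of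
    [u j] or in the opposite one, so that [ip f (u j)] becomes large; the later
    moves are too small to destroy this. Those after step [j] have total norm at most [3 ^- j / 2], so
    that at least half of the [3 ^- j * |u j|] gained at step [j] survives. *)
Lemma gliding_hump (u : nat -> V) : (forall j, H (u j)) ->
  (forall j, 2 * j%:R * 3 ^+ j <= nrm (u j)) ->
  exists2 f, H f & forall j, j%:R <= cabs (ip f (u j)).
Proof.
move=> Hu u_large.
have three_gt0 j : 0 < (3 ^+ j : R) by rewrite exprn_gt0.
pose s j := creal (3 ^- j / nrm (u j)) *: u j.
have Hs j : H (s j) by exact: hilbertZ.
have ip_s j : ip (s j) (u j) = creal (3 ^- j * nrm (u j)).
  rewrite ipZ// -[ip _ _]cre_eq ?ip_ge0// -nrm_sqr// -crealM; congr creal.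
  by have [->|u0] := eqVneq (nrm (u j)) 0; [rewrite expr0n /= !mulr0|rewrite expr2 mulrA divfK].
have nrm_s j : nrm (s j) <= 3 ^- j.
  rewrite nrmZ// cabs_creal ?mulr_ge0 ?invr_ge0 ?nrm_ge0 ?(ltW (three_gt0 j))//.
  have [->|u0] := eqVneq (nrm (u j)) 0; first by rewrite mulr0 invr_ge0 ltW.
  by rewrite divfK.
pose next j x := if 3 ^- j * nrm (u j) <= cabs (ip (x + s j) (u j))
  then x + s j else x - s j.
have H_next j x : H x -> H (next j x).
  by rewrite /next => Hx; case: ifP => _; [exact: hilbertD|exact: hilbertB].
have next_large j x : H x -> 3 ^- j * nrm (u j) <= cabs (ip (next j x) (u j)).
  move=> Hx; rewrite /next; case: ifPn => [//|]; rewrite -ltNge => small.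
  rewrite ipB// ip_s; move: small; rewrite ipD// ip_s.
  set t := 3 ^- j * _; set a := ip x _ => small.
  have t0 : 0 <= t by rewrite mulr_ge0 ?invr_ge0 ?nrm_ge0 ?ltW.
  have : cabs (creal t + creal t) <= cabs (a + creal t) + cabs (a - creal t).
    rewrite -(cabsN (a - _)); have -> : creal t + creal t = a + creal t - (a - creal t).
      by rewrite opprB [RHS]addrC addrA subrK.
    exact: cabsD.
  by rewrite -crealD cabs_creal ?addr_ge0//; lra.
have next_near j x : H x -> nrm (next j x - x) <= 3 ^- j.
  move=> Hx; rewrite /next; case: ifP => _; first by rewrite addrAC subrr add0r.
  by rewrite addrAC subrr add0r -scaleN1r nrmZ// cabsN cabs1 mul1r.
pose x := fix x j := if j is i.+1 then next i (x i) else 0.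
have Hx j : H (x j) by elim: j => [|j IH]; [exact: (hilbert0 hs)|exact: H_next].
have x_cauchy i j : (i <= j)%N -> nrm (x j - x i) <= 3 / 2 * 3 ^- i.
  move=> /subnKC <-; move: (j - i)%N => k.
  suff : nrm (x (i + k)%N - x i) <= 3 / 2 * (3 ^- i - 3 ^- (i + k)).
    by move=> /le_trans; apply; rewrite ler_wpM2l// gerBl invr_ge0 ltW.
  elim: k => [|k IH]; first by rewrite addn0 !subrr nrm0 mulr0.
  rewrite addnS; have := nrm_triangle (Hx (i + k).+1) (Hx (i + k)%N) (Hx i).
  have := next_near (i + k)%N _ (Hx (i + k)%N); rewrite -/(x (i + k).+1) exprSr invfM.
  by move: IH; lra.
have pow_small (d : R) : 0 < d -> exists N, forall i, (N <= i)%N -> 3 / 2 * 3 ^- i < d.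
  move=> d0; exists (Num.Def.truncn (3 / 2 / d)) => i Ni.
  rewrite ltr_pdivrMr// [ltRHS]mulrC -ltr_pdivrMr//.
  rewrite (lt_le_trans (truncnS_gt _))// -natrX ler_nat.
  by rewrite (leq_trans (_ : _ <= i.+1)%N)// ltn_expl.
have [f Hf xf] := hilbert_limit Hx pow_small x_cauchy.
exists f => // j.
have := xf j.+1; have := next_large j _ (Hx j); rewrite -/(x j.+1).
have := cauchy_schwarz (hilbertB (Hx j.+1) Hf) (Hu j); rewrite ipB//.
have := cabsD (ip (x j.+1) (u j) - ip f (u j)) (ip f (u j)); rewrite subrK.
have : j%:R <= 2^-1 * (3 ^- j * nrm (u j)).
  by rewrite mulrA -invfM mulrC ler_pdivlMr ?mulr_gt0// mulrCA mulrA u_large.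
rewrite exprSr invfM.
have : 0 <= nrm (u j) by exact: nrm_ge0.
have : 0 <= (3 ^- j : R) by rewrite invr_ge0 ltW.
nra.
Qed.

End HilbertTheory.

Section DenseParametrization.
Variables (R : realType) (V W : lmodType (Cplx R)).
Local Notation C := (Cplx R).
Variables (H : set V) (ip : V -> V -> C).
Hypothesis hs : hilbert_space H ip.
Variable phi : W -> V.
Hypothesis phiH : forall q, H (phi q).
Hypothesis phiD : forall q1 q2, phi (q1 + q2) = phi q1 + phi q2.
Hypothesis phiZ : forall a q, phi (a *: q) = a *: phi q.
Hypothesis phi_dense : forall f, H f -> forall e : R, 0 < e ->
  exists q, hnorm ip (f - phi q) < e.

Let P := range phi.

Let PH : P `<=` H. Proof. by move=> _ [q _ <-]. Qed.

Let P_dense f : H f -> forall e : R, 0 < e -> exists2 q, P q & hnorm ip (f - q) < e.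
Proof. by move=> Hf e /(phi_dense Hf)[q fq]; exists (phi q) => //; exists q. Qed.

Lemma functional_bound_range u (M : R) : H u -> 0 <= M ->
  (forall q, cabs (ip (phi q) u) <= M * hnorm ip (phi q)) ->
  forall f, H f -> cabs (ip f u) <= M * hnorm ip f.
Proof.
by move=> Hu M0 uM; apply: (functional_bound_dense hs PH P_dense Hu M0) => _ [q _ <-].
Qed.

Lemma eq_functional_range u v : H u -> H v ->
  (forall q, ip (phi q) u = ip (phi q) v) -> forall f, H f -> ip f u = ip f v.
Proof.
by move=> Hu Hv uv; apply: (eq_functional_dense hs PH P_dense Hu Hv) => _ [q _ <-].
Qed.

(** The functional is given on the parameters rather than on the vectors; the
    bound makes it well defined on the range of [phi]. *)
Lemma riesz_range (l : W -> C) (M : R) :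
  (forall q1 q2, l (q1 + q2) = l q1 + l q2) ->
  (forall a q, l (a *: q) = a * l q) ->
  (forall q, cabs (l q) <= M * hnorm ip (phi q)) ->
  exists2 u, H u & forall q, l q = ip (phi q) u.
Proof.
move=> lD lZ lM.
pose L v : C := l (xget 0 [set q | phi q = v]).
have LE q : L (phi q) = l q.
  rewrite /L; case: xgetP => [q' _ /= q'q|/(_ q) []//].
  apply/eqP; rewrite -subr_eq0 -normr_le0 -creal0 cabs_le.
  by have := lM (q' + (-1) *: q); rewrite lD lZ mulN1r phiD phiZ q'q scaleN1r subrr (nrm0 hs) mulr0.
have [||||| u Hu uE] := @riesz_dense _ _ _ _ hs _ PH _ _ P_dense L M.
- by move=> _ _ [q1 _ <-] [q2 _ <-]; exists (q1 + q2).
- by move=> a _ [q1 _ <-]; exists (a *: q1).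
- by move=> _ _ [q1 _ <-] [q2 _ <-]; rewrite -phiD !LE lD.
- by move=> a _ [q1 _ <-]; rewrite -phiZ !LE lZ.
- by move=> _ [q1 _ <-]; rewrite LE.
by exists u => // q; rewrite -LE uE//; exists q.
Qed.

End DenseParametrization.

(** * Transport of structure and differentiability *)

Lemma hilbert_transport (R : realType) (V W : lmodType (Cplx R)) (H : set V)
    (ip : V -> V -> Cplx R) (T : V -> W) (ipT : W -> W -> Cplx R) :
  hilbert_space H ip ->
  (forall a u v, H u -> H v -> T (a *: u + v) = a *: T u + T v) ->
  (forall u v, H u -> H v -> ipT (T u) (T v) = ip u v) ->
  hilbert_space (T @` H) ipT.
Proof.
move=> hs TP Tip.
have T0 : T 0 = 0.
  have := TP (-1) 0 0 (hilbert0 hs) (hilbert0 hs).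
  by rewrite scaler0 addr0 scaleN1r addNr.
have TB u v : H u -> H v -> T (u - v) = T u - T v.
  by move=> Hu Hv; rewrite addrC -scaleN1r TP// scaleN1r addrC.
split.
- by exists 0; [exact: (hilbert0 hs)|].
- move=> a _ _ [u Hu <-] [v Hv <-]; exists (a *: u + v); last exact: TP.
  exact: (hilbertP hs).
- move=> a _ _ _ [u Hu <-] [v Hv <-] [w Hw <-].
  by rewrite -TP// !Tip ?(hilbert_linear hs)//; exact: (hilbertP hs).
- by move=> _ _ [u Hu <-] [v Hv <-]; rewrite !Tip// (hilbert_sym hs).
- move=> _ [u Hu <-] Tu0; rewrite Tip//; apply: (hilbert_pos hs) => //.
  by apply: contra_neq Tu0 => ->.
- move=> x Hx x_cauchy.
  have /choice[y yP] i : exists u, H u /\ T u = x i by have [u Hu <-] := Hx i; exists u.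
  have Hy i := (yP i).1; have yx i := (yP i).2.
  have nE u v : H u -> H v -> hnorm ipT (T u - T v) = hnorm ip (u - v).
    by move=> Hu Hv; rewrite -TB// /hnorm Tip//; exact: (hilbertB hs).
  have [|u Hu yu] := hilbert_complete hs Hy.
    move=> e /x_cauchy[N NP]; exists N => i j Ni Nj.
    by have := NP i j Ni Nj; rewrite -!yx nE.
  exists (T u); first by exists u.
  apply: cvg_trans yu; apply: near_eq_cvg; near=> i.
  by rewrite -yx nE.
Unshelve. all: by end_near. Qed.

Lemma differentiable_quadratic_remainder (C : numFieldType) (V W : normedModType C)
    (f : V -> W) (l : {linear V -> W}) (x : V) (r K : C) :
  continuous l -> 0 < r -> 0 <= K ->
  (forall h, `|h| < r -> `|f (x + h) - f x - l h| <= K * `|h| ^+ 2) ->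
  differentiable f x.
Proof.
move=> l_cont r0 K0 fl.
have fxl : f \o shift x = cst (f x) + l +o_ 0 id.
  apply/eqaddoP => e e0; have K1 : 0 < K + 1 by rewrite ltr_wpDl.
  have [b [b0 br bK]] := pos_lower_bound r0 (divr_gt0 e0 K1).
  apply/nbhs_norm0P; exists b => // h /= hb.
  have -> : (f \o shift x - (cst (f x) + l)) h = f (x + h) - f x - l h.
    by rewrite /= [x + h]addrC -addrA -opprD.
  apply: le_trans (fl h (lt_le_trans hb br)) _.
  rewrite expr2 mulrA ler_wpM2r//.
  apply: (@le_trans _ _ ((K + 1) * (e / (K + 1)))); last first.
    by rewrite mulrC divfK// gt_eqF.
  apply: ler_pM => //; first by rewrite lerDl.
  by rewrite ltW// (lt_le_trans hb).
by apply/diff_locallyP; rewrite (diff_unique l_cont fxl).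
Qed.

Lemma divrX_mulrX (F : fieldType) (a x s : F) m :
  a / s ^+ m * x ^+ m = a * (x / s) ^+ m.
Proof. by rewrite expr_div_n mulrAC mulrA. Qed.

Lemma affine_remainder_coord (C : pzRingType) n m (a b : 'cV[C]_m) (L : 'M[C]_(m, n))
    (h : 'cV[C]_n) k :
  (a - b - L *m h) k 0 = a k 0 - b k 0 - \sum_i L k i * h i 0.
Proof. by rewrite !mxE. Qed.

Lemma differentiable_taylor (C : numFieldType) (n m : nat)
    (f : 'cV[C]_n -> 'cV[C]_m) (x : 'cV[C]_n) (L : 'M[C]_(m, n)) (r K : C) :
  0 < r -> 0 <= K ->
  (forall h, `|h| < r -> `|f (x + h) - f x - L *m h| <= K * `|h| ^+ 2) ->
  differentiable f x.
Proof.
move=> r0 K0 fL; pose S := \sum_i \sum_j `|L i j|.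
have S0 : 0 <= S by apply: sumr_ge0 => i _; exact: sumr_ge0.
have LS (h : 'cV[C]_n) : `|L *m h| <= S * `|h|.
  apply: norm_col_le => [|i]; first exact: mulr_ge0.
  rewrite mxE (le_trans (ler_norm_sum _ _ _))// /S (bigD1 i)//= mulrDl.
  rewrite ler_wpDr ?mulr_ge0 ?sumr_ge0// => [j _|]; first exact: sumr_ge0.
  rewrite mulr_suml; apply: ler_sum => j _.
  by rewrite normrM ler_wpM2l// norm_coord_le.
pose l : {linear 'cV[C]_n -> 'cV[C]_m} := mulmx L.
have l_cont : continuous l.
  move=> z; apply/(@cvgrPdistC_lt _ _ _ (nbhs z)) => e e0.
  have S1 : 0 < S + 1 by rewrite ltr_wpDl.
  apply/(@nbhs_normP C 'cV[C]_n z); exists (e / (S + 1)); first exact: divr_gt0.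
  move=> v /=; rewrite distrC -mulmxBr => vz; apply: le_lt_trans (LS _) _.
  rewrite (@le_lt_trans _ _ ((S + 1) * `|v - z|))//; first by rewrite ler_wpM2r// lerDl.
  by rewrite mulrC -ltr_pdivlMr.
apply: (@differentiable_quadratic_remainder _ _ _ f l x r K) => //.
Qed.
(** * The coefficient map of the Hilbert module *)

Section CoefficientMap.
Variables (R : realType) (n : nat) (gT : finGroupType) (G : {group gT}).
Local Notation C := (Cplx R).
Variable rG : mx_representation C G n.
Hypothesis rG_faithful : mx_faithful rG.
Variable Omega : set 'cV[C]_n.
Hypothesis Omega_domain : domain Omega.
Hypothesis Omega_invariant : invariant_set rG Omega.
Variable theta : n.-tuple (mpoly n C).
Hypothesis theta_hsop : hsop rG theta.
Variable p : 'I_#|G| -> mpoly n C.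
Hypothesis p_basis : invariant_basis rG p.
Variable H : set ('cV[C]_n -> 'cV[C]_1).
Variable ip : ('cV[C]_n -> 'cV[C]_1) -> ('cV[C]_n -> 'cV[C]_1) -> C.
Hypothesis H_module : analytic_hilbert_module Omega H ip.
Variable K : 'cV[C]_n -> 'cV[C]_n -> 'M[C]_1.
Hypothesis K_kernel : reproducing_kernel Omega H ip K.
Hypothesis K_invariant : forall g z w, g \in G -> Omega z -> Omega w ->
  K (rG g *m z) (rG g *m w) = K z w.
Implicit Types (q : mpoly n C) (z w : 'cV[C]_n) (f : 'cV[C]_n -> 'cV[C]_1).

Local Notation d := #|G|.
Local Notation th := (quotient_map theta).
Local Notation D := (th @` Omega).
Local Notation nrm := (hnorm ip).

Let hs : hilbert_space H ip := ahm_hilbert H_module.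
Let theta_inv : forall i, invariant rG (tnth theta i) := hsop_invariant theta_hsop.
Let theta_ind : forall q, comp_mpoly theta q = 0 -> q = 0 := hsop_algindep theta_hsop.
Let theta_gen : forall q, invariant rG q -> exists r, q = comp_mpoly theta r :=
  @hsop_generate _ _ _ _ _ _ theta_hsop.
Let p_span : forall q, exists2 c : 'I_d -> mpoly n C,
    (forall k, invariant rG (c k)) & q = \sum_(k < d) c k * p k :=
  ibasis_span p_basis.
Let p_free : forall c : 'I_d -> mpoly n C, (forall k, invariant rG (c k)) ->
    \sum_(k < d) c k * p k = 0 -> forall k, c k = 0 :=
  @ibasis_free _ _ _ _ _ _ _ p_basis.

Let Q q : 'I_d -> mpoly n C := coords theta_gen p_span q.

Definition polyfun q : 'cV[C]_n -> 'cV[C]_1 :=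
  ext0 Omega (polymap (fun _ : 'I_1 => q)).

Lemma ext0_in (m : nat) (A : set 'cV[C]_n) (F : 'cV[C]_n -> 'cV[C]_m) z :
  A z -> ext0 A F z = F z.
Proof. by move=> Az; rewrite /ext0 /patch mem_set. Qed.

Lemma ext0_out (m : nat) (A : set 'cV[C]_n) (F : 'cV[C]_n -> 'cV[C]_m) z :
  ~ A z -> ext0 A F z = 0.
Proof. by move=> Az; rewrite /ext0 /patch memNset. Qed.

Lemma eq_ext0 (m : nat) (A : set 'cV[C]_n) (F1 F2 : 'cV[C]_n -> 'cV[C]_m) :
  (forall z, A z -> F1 z = F2 z) -> ext0 A F1 = ext0 A F2.
Proof.
move=> F12; apply/funext => z; have [Az|Az] := pselect (A z).
  by rewrite !ext0_in// F12.
by rewrite !ext0_out.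
Qed.

Lemma polyfunE q z : Omega z -> polyfun q z 0 0 = colval q z.
Proof. by move=> Oz; rewrite /polyfun ext0_in// mxE. Qed.

Lemma polyfunH q : H (polyfun q).
Proof. exact: (ahm_poly H_module). Qed.

Lemma polyfunD q1 q2 : polyfun (q1 + q2) = polyfun q1 + polyfun q2.
Proof.
apply/funext => z; rewrite !fctE; have [Oz|Oz] := pselect (Omega z).
  by apply/colP => i; rewrite (ord1 i) mxE !polyfunE// colvalD.
by rewrite /polyfun !ext0_out// addr0.
Qed.

Lemma polyfunZ a q : polyfun (a *: q) = a *: polyfun q.
Proof.
apply/funext => z; rewrite !fctE; have [Oz|Oz] := pselect (Omega z).
  by apply/colP => i; rewrite (ord1 i) mxE !polyfunE// colvalZ.
by rewrite /polyfun !ext0_out// scaler0.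
Qed.

Lemma polyfun_dense f : H f -> forall e : R, 0 < e -> exists q, nrm (f - polyfun q) < e.
Proof.
move=> Hf e /(ahm_dense H_module Hf)[q fq]; exists (q 0).
have -> : polyfun (q 0) = ext0 Omega (polymap q).
  by apply: eq_ext0 => z _; apply/colP => i; rewrite [LHS]mxE [RHS]mxE (ord1 i).
exact: fq.
Qed.

Lemma Omega_act g z : g \in G -> Omega z -> Omega (rG g *m z).
Proof. by move=> gG Oz; rewrite -(Omega_invariant gG); exists z. Qed.

(** ** Point evaluations *)

Definition point_kernel w : 'cV[C]_n -> 'cV[C]_1 :=
  ext0 Omega (fun z => K z w *m (const_mx 1 : 'cV[C]_1)).

Lemma point_kernelH w : Omega w -> H (point_kernel w).
Proof. by move=> Ow; have [] := K_kernel Ow (const_mx 1). Qed.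

Lemma ip_point_kernel f w : H f -> Omega w -> ip f (point_kernel w) = f w 0 0.
Proof.
move=> Hf Ow; have [_ /(_ f Hf) ->] := K_kernel Ow (const_mx 1).
by rewrite /cdot big_ord1 mxE rmorph1 mulr1.
Qed.

(** The square of the norm is the value of [K] on the diagonal. *)
Lemma nrm_point_kernel_act g w : g \in G -> Omega w ->
  nrm (point_kernel (rG g *m w)) = nrm (point_kernel w).
Proof.
move=> gG Ow; have Ogw := Omega_act gG Ow.
have E v : Omega v -> ip (point_kernel v) (point_kernel v) = (K v v *m (const_mx 1 : 'cV[C]_1)) 0 0.
  by move=> Ov; rewrite (ip_point_kernel (point_kernelH Ov) Ov) /point_kernel (ext0_in _ Ov).
by rewrite /hnorm (E _ Ow) (E _ Ogw) (K_invariant gG Ow Ow).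
Qed.

Lemma small_inverse (b : C) (m : nat) : 0 < b -> exists j, (m <= j)%N /\ (j.+1%:R^-1 : C) < b.
Proof.
move=> b0; have r0 := cre_gt0 b0; exists (m + Num.Def.truncn (cre b)^-1)%N.
split; first exact: leq_addr.
rewrite -(cre_eq (ltW b0)) -creal_natV creal_lt invf_plt ?posrE ?ltr0n//.
by rewrite (lt_le_trans (truncnS_gt _))// ler_nat ltnS leq_addl.
Qed.

(** Otherwise there are points [x j] tending to [z0] at which the norms grow as
    fast as [gliding_hump] requires; it gives an element of [H] that is unbounded
    along the [x j], although it is continuous at [z0]. *)
Lemma point_kernel_locally_bounded z0 : Omega z0 -> exists (b : C) (B : R),
  [/\ 0 < b, 0 <= B & forall z, `|z - z0| < b -> Omega z /\ nrm (point_kernel z) <= B].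
Proof.
move=> Oz0; have [_ Oopen _] := Omega_domain.
have /(@nbhs_normP C 'cV[C]_n z0)[b0 b00 b0P] : nbhs z0 Omega by exact: open_nbhs_nbhs.
apply: contrapT => Hn.
have /choice[x xP] j : exists z, [/\ `|z - z0| < j.+1%:R^-1, Omega z &
    2 * j%:R * 3 ^+ j <= nrm (point_kernel z)].
  apply: contrapT => Hj; apply: Hn.
  have j0 : 0 < (j.+1%:R^-1 : C) by rewrite invr_gt0 ltr0n.
  have [b [bb0 b1 b2]] := pos_lower_bound b00 j0.
  exists b, (2 * j%:R * 3 ^+ j); split=> // z zb.
  have Oz : Omega z by apply: (b0P z); rewrite /= distrC (lt_le_trans zb b1).
  split=> //; rewrite leNgt; apply/negP => big; apply: Hj; exists z; split=> //.
    exact: lt_le_trans zb b2.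
  exact: ltW.
have xz j : `|x j - z0| < j.+1%:R^-1 by have [] := xP j.
have Ox j : Omega (x j) by have [] := xP j.
have x_large j : 2 * j%:R * 3 ^+ j <= nrm (point_kernel (x j)) by have [] := xP j.
have [f Hf fx] := gliding_hump hs (fun j => point_kernelH (Ox j)) x_large.
have f_cont : {for z0, continuous f}.
  by apply: differentiable_continuous; have [_] := ahm_holomorphic H_module Hf; apply.
have f_near := proj1 (@cvgrPdistC_lt _ _ _ (nbhs z0) (nbhs_filter z0) _ _) f_cont 1 ltr01.
have [b b1 bP] := proj1 (@nbhs_normP C 'cV[C]_n z0 _) f_near.
have [j [jm jb]] := small_inverse (Num.Def.truncn (cabs (f z0 0 0) + 1)).+1 b1.
have := bP (x j); rewrite /= distrC => /(_ (lt_trans (xz j) jb)) fxj.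
have := fx j; rewrite ip_point_kernel//.
have : cabs (f (x j) 0 0 - f z0 0 0) <= 1.
  rewrite -cabs_le creal1; have := norm_coord_le (f (x j) - f z0) 0; rewrite !mxE.
  by move=> /le_trans; apply; exact: ltW.
have := cabsD (f (x j) 0 0 - f z0 0 0) (f z0 0 0); rewrite subrK.
have : cabs (f z0 0 0) + 1 < j%:R by rewrite (lt_le_trans (truncnS_gt _))// ler_nat.
lra.
Qed.

Lemma QD q1 q2 k : Q (q1 + q2) k = Q q1 k + Q q2 k.
Proof. exact: (coordsD theta_inv theta_ind theta_gen p_span p_free). Qed.

Lemma QZ a q k : Q (a *: q) k = a *: Q q k.
Proof. exact: (coordsZ theta_inv theta_ind theta_gen p_span p_free). Qed.

Lemma colvalQ q z : colval q z = \sum_(k < d) colval (Q q k) (th z) * colval (p k) z.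
Proof. exact: colval_coords. Qed.

Lemma polyfun_orbit_bound q g z (B : R) : g \in G -> Omega z -> nrm (point_kernel z) <= B ->
  cabs (colval q (rG g *m z)) <= B * nrm (polyfun q).
Proof.
move=> gG Oz zB; have Ogz := Omega_act gG Oz.
rewrite -(polyfunE q Ogz) -(ip_point_kernel (polyfunH q) Ogz).
apply: le_trans (cauchy_schwarz hs (polyfunH q) (point_kernelH Ogz)) _.
rewrite (nrm_point_kernel_act gG Oz) mulrC; apply: ler_wpM2r => //; exact: nrm_ge0.
Qed.

Lemma coords_locally_bounded z0 : Omega z0 -> exists (b : C) (B : R),
  [/\ 0 < b, 0 <= B & forall q k z, `|z - z0| < b ->
     cabs (colval (Q q k) (th z)) <= B * nrm (polyfun q)].
Proof.
move=> Oz0; have [e [B [e0 B0 eB]]] := point_kernel_locally_bounded Oz0.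
have [b [c [b0 c0 bc]]] := coords_bound rG_faithful theta_inv theta_gen
  p_span z0 e0.
exists b, (cre c * B); split=> [//||q k z zb]; first by rewrite mulr_ge0 ?cre_ge0.
rewrite -cabs_le -mulrA crealM (cre_eq c0); apply: bc zb => x i xe.
have [Ox kx] := eB x xe; rewrite cabs_le.
by apply: polyfun_orbit_bound => //; exact: enum_valP.
Qed.

(** By openness the points near [theta z0] are images of points near [z0]. *)
Lemma quotient_locally_bounded w0 : D w0 -> exists (r : C) (B : R),
  [/\ 0 < r, 0 <= B & forall w, `|w - w0| < r -> D w /\
    forall q k, cabs (colval (Q q k) w) <= B * nrm (polyfun q)].
Proof.
move=> [z0 Oz0 <-]; have [b [B [b0 B0 bB]]] := coords_locally_bounded Oz0.
have [e [B1 [e0 _ eO]]] := point_kernel_locally_bounded Oz0.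
have [s [s0 sb se]] := pos_lower_bound b0 e0.
have [r r0 rP] := quotient_map_open theta_inv theta_ind theta_gen p_span p_free z0 s0.
exists r, B; split=> // w /rP[z zs <-]; split.
  by exists z => //; have [] := eO z (lt_le_trans zs se).
by move=> q k; apply: bB; exact: lt_le_trans zs sb.
Qed.

Lemma quotient_domain : domain D.
Proof.
have [[z0 Oz0] _ Oconn] := Omega_domain; split; first by exists (th z0), z0.
  rewrite openE => w0 Dw0; have [r [B [r0 _ rP]]] := quotient_locally_bounded Dw0.
  apply/(@nbhs_normP C 'cV[C]_n w0); exists r => // w /=; rewrite distrC => wr.
  by have [] := rP w wr.
apply: connected_continuous_connected => //.
apply: continuous_subspaceT; exact: quotient_map_continuous.
Qed.

Lemma coord_functional w k : D w ->
  exists u, H u /\ forall q, colval (Q q k) w = ip (polyfun q) u.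
Proof.
move=> Dw; have [r [B [r0 _ rP]]] := quotient_locally_bounded Dw.
have wr : `|w - w| < r by rewrite subrr normr0.
have [_ wB] := rP w wr.
have [q1 q2|a q|q|u Hu uE] := @riesz_range _ _ _ _ _ hs _ polyfunH polyfunD polyfunZ polyfun_dense
    (fun q => colval (Q q k) w) B.
- by rewrite QD colvalD.
- by rewrite QZ colvalZ.
- exact: wB.
by exists u; split.
Qed.

(** This element extends the [k]-th coordinate at [w] from the polynomials to
    [H]. *)
Definition coef_kernel k w : 'cV[C]_n -> 'cV[C]_1 :=
  xget 0 [set u | H u /\ forall q, colval (Q q k) w = ip (polyfun q) u].

Lemma coef_kernelP k w : D w ->
  H (coef_kernel k w) /\ forall q, colval (Q q k) w = ip (polyfun q) (coef_kernel k w).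
Proof. by move=> /(coord_functional k)/(xgetPex 0). Qed.

Definition coef_map f : 'cV[C]_n -> 'cV[C]_d := ext0 D (fun w => \col_k ip f (coef_kernel k w)).

Lemma coef_mapE f w k : D w -> coef_map f w k 0 = ip f (coef_kernel k w).
Proof. by move=> Dw; rewrite /coef_map (ext0_in _ Dw) mxE. Qed.

(** For fixed [z] both sides are scalar products of [f] with fixed elements of
    [H], and they agree when [f] is a polynomial. *)
Lemma coef_map_decomposes f z : H f -> Omega z ->
  f z 0 0 = \sum_(k < d) colval (p k) z * coef_map f (th z) k 0.
Proof.
move=> Hf Oz; have Dz : D (th z) by exists z.
have Hu k := (coef_kernelP k Dz).1.
transitivity (ip f (\sum_k (colval (p k) z)^* *: coef_kernel k (th z))).
  rewrite -(ip_point_kernel Hf Oz).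
  apply: (eq_functional_range hs polyfunH polyfun_dense (point_kernelH Oz)
    (hilbert_lincomb hs _ Hu)) Hf => q.
  rewrite (ip_point_kernel (polyfunH q) Oz) (polyfunE q Oz).
  rewrite (ip_lincombC hs (fun k => colval (p k) z) Hu (polyfunH q)) colvalQ.
  by apply: eq_bigr => k _; rewrite -(coef_kernelP k Dz).2 mulrC.
rewrite (ip_lincombC hs (fun k => colval (p k) z) Hu Hf); apply: eq_bigr => k _.
by rewrite (coef_mapE _ _ Dz).
Qed.

(** The partial derivatives at [w0] of the coordinates of polynomials are bounded
    functionals too, by Cauchy's estimate; the elements [du] of [H] representing
    them give the differential. The Taylor remainder is the scalar product of [f]
    with an element [U] of [H], so that its bound, quadratic in [h], need only be
    checked on polynomials. *)
Lemma coef_map_differentiable f w0 : H f -> D w0 -> differentiable (coef_map f) w0.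
Proof.
move=> Hf Dw0; have [r [B [r0 B0 rP]]] := quotient_locally_bounded Dw0.
pose s := r / 2; have s0 : 0 < s by rewrite divr_gt0.
have s_r h : `|h - w0| <= s -> `|h - w0| < r.
  move=> /le_lt_trans; apply; rewrite ltr_pdivrMr// mulr_natr mulr2n.
  by rewrite ltrDl.
have sQ q k v : `|v - w0| <= s -> `|colval (Q q k) v| <= creal (B * nrm (polyfun q)).
  by move=> vs; rewrite cabs_le; have [_] := rP v (s_r v vs).
have grad_functional ki : exists u, H u /\
    forall q, pgrad (Q q ki.1) w0 0 ki.2 = ip (polyfun q) u.
  have [q1 q2|a q|q|u Hu uE] := @riesz_range _ _ _ _ _ hs _ polyfunH polyfunD polyfunZ polyfun_dense
    (fun q => pgrad (Q q ki.1) w0 0 ki.2) (cre s^-1 * B).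
  - by rewrite (QD q1 q2 ki.1); exact: pgradD.
  - by rewrite (QZ a q ki.1); exact: pgradZ.
  - rewrite -cabs_le -mulrA crealM cre_eq ?invr_ge0 ?(ltW s0)// mulrC ler_pdivlMr//.
    by apply: pgrad_bound => // v; exact: sQ.
  by exists u; split.
have [du duP] := choice grad_functional.
have Hdu ki := (duP ki).1; have duE ki := (duP ki).2.
pose L : 'M[C]_(d, n) := \matrix_(k, i) ip f (du (k, i)).
pose c : C := 2%:R * creal (B * nrm f) / s ^+ 2.
have s20 : 0 < s / 2 by rewrite divr_gt0.
have c0 : 0 <= c.
  rewrite divr_ge0 ?exprn_ge0 ?(ltW s0)// mulr_ge0// -creal0 creal_le mulr_ge0//.
  exact: nrm_ge0.
apply: (differentiable_taylor (L := L) s20 c0) => h hs2.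
have Dh : D (w0 + h).
  have hr : `|w0 + h - w0| < r.
    apply: s_r; rewrite addrC addKr (le_trans (ltW hs2))//.
    by rewrite ler_pdivrMr// mulr_natr mulr2n lerDl ltW.
  by have [] := rP (w0 + h) hr.
pose t := cre (`|h| / s).
have tE : creal t = `|h| / s by rewrite cre_eq// divr_ge0// ltW.
have t0 : 0 <= t by rewrite cre_ge0// divr_ge0// ltW.
have ctE x : creal (2 * B * t ^+ 2 * x) = 2%:R * creal (B * x) * (`|h| / s) ^+ 2.
  by rewrite -tE -crealX -creal2 -crealM; congr creal; ring.
apply: norm_col_le => [|k]; first by rewrite mulr_ge0// exprn_ge0.
have Hu w (Dw : D w) := (coef_kernelP k Dw).1; have uE w (Dw : D w) := (coef_kernelP k Dw).2.
pose U := coef_kernel k (w0 + h) - coef_kernel k w0 - \sum_i (h i 0)^* *: du (k, i).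
have Hs : H (\sum_i (h i 0)^* *: du (k, i)).
  exact (hilbert_lincomb hs (fun i => (h i 0)^*) (fun i => Hdu (k, i))).
have Huu : H (coef_kernel k (w0 + h) - coef_kernel k w0).
  exact: (hilbertB hs (Hu _ Dh) (Hu _ Dw0)).
have HU : H U by exact: (hilbertB hs Huu Hs).
have ipU g : H g -> ip g U =
    ip g (coef_kernel k (w0 + h)) - ip g (coef_kernel k w0) - \sum_i h i 0 * ip g (du (k, i)).
  move=> Hg; rewrite (ipBr hs Huu Hs Hg) (ipBr hs (Hu _ Dh) (Hu _ Dw0) Hg).
  by rewrite (ip_lincombC hs (fun i => h i 0) (fun i => Hdu (k, i)) Hg).
have -> : c * `|h| ^+ 2 = creal (2 * B * t ^+ 2 * nrm f).
  by rewrite ctE; exact: divrX_mulrX.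
rewrite affine_remainder_coord (coef_mapE _ _ Dh) (coef_mapE _ _ Dw0).
have -> : \sum_i L k i * h i 0 = \sum_i h i 0 * ip f (du (k, i)).
  by apply: eq_bigr => i _; rewrite mxE mulrC.
rewrite -(ipU f Hf) cabs_le.
apply: (functional_bound_range hs polyfunH polyfun_dense HU _ _ Hf) => [|q].
  by rewrite !mulr_ge0// sqr_ge0.
rewrite -cabs_le ctE (ipU _ (polyfunH q)) -(uE _ Dh) -(uE _ Dw0).
have -> : \sum_i h i 0 * ip (polyfun q) (du (k, i)) = (pgrad (Q q k) w0 *m h) 0 0.
  by rewrite [RHS]mxE; apply: eq_bigr => i _; rewrite -duE mulrC.
by apply: (colval_taylor_bound s0 _ (ltW hs2)) => v; exact: sQ.
Qed.

Lemma coef_map_linear a f g : H f -> H g -> coef_map (a *: f + g) = a *: coef_map f + coef_map g.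
Proof.
move=> Hf Hg; apply/funext => w; rewrite -[RHS]/(a *: coef_map f w + coef_map g w).
have [Dw|Dw] := pselect (D w); last first.
  by rewrite /coef_map !(ext0_out _ Dw) scaler0 addr0.
apply/colP => k; rewrite (coef_mapE _ _ Dw) col_lincombE (coef_mapE _ _ Dw) (coef_mapE _ _ Dw).
exact: (hilbert_linear hs a Hf Hg (coef_kernelP k Dw).1).
Qed.

Lemma coef_map_ext0 f : ext0 D (coef_map f) = coef_map f.
Proof. by apply: eq_ext0 => w Dw; rewrite /coef_map (ext0_in _ Dw). Qed.

Lemma continuous_coords_unique (F1 F2 : 'cV[C]_n -> 'cV[C]_d) :
  ext0 D F1 = F1 -> ext0 D F2 = F2 ->
  (forall w, D w -> {for w, continuous F1}) ->
  (forall w, D w -> {for w, continuous F2}) ->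
  (forall z, Omega z -> \sum_(k < d) colval (p k) z * F1 (th z) k 0 =
                        \sum_(k < d) colval (p k) z * F2 (th z) k 0) ->
  F1 = F2.
Proof.
move=> F10 F20 F1c F2c F12; rewrite -F10 -F20; apply: eq_ext0 => _ [z0 Oz0 <-].
have [_ Oopen _] := Omega_domain; have Dz0 : D (th z0) by exists z0.
pose F w := F1 w - F2 w.
suff : F (th z0) = 0 by rewrite /F => /eqP; rewrite subr_eq0 => /eqP.
apply: (continuous_coords_eq0 rG_faithful theta_inv theta_gen p_span Oopen Omega_act Oz0).
  exact: (cvgB (F1c _ Dz0) (F2c _ Dz0)).
move=> z Oz; rewrite (eq_bigr _ (fun k _ => congr1 _ (col_subE _ _ k))).
rewrite (eq_bigr _ (fun k _ => mulrBr _ _ _)) sumrB (F12 z Oz); exact: subrr.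
Qed.

Lemma coef_map_decomposition f : H f -> decomposition theta p Omega f (coef_map f).
Proof.
move=> Hf; split; last by move=> z Oz; exact: (coef_map_decomposes Hf Oz).
by split; [exact: coef_map_ext0|move=> w Dw; exact: (coef_map_differentiable Hf Dw)].
Qed.

Lemma decomposition_unique f F : H f -> decomposition theta p Omega f F -> F = coef_map f.
Proof.
move=> Hf [[F0 Fd] FE]; apply: continuous_coords_unique => //.
- exact: coef_map_ext0.
- by move=> w Dw; apply: differentiable_continuous; exact: Fd.
- by move=> w Dw; apply: differentiable_continuous; exact: (coef_map_differentiable Hf Dw).
- by move=> z Oz; rewrite -(coef_map_decomposes Hf Oz) (FE z Oz).
Qed.

Lemma GammaE f : H f -> Gamma theta p Omega f = coef_map f.
Proof.
move=> Hf; apply: (xget_unique 0 (coef_map_decomposition Hf)) => F.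
exact: decomposition_unique.
Qed.

Lemma coef_map_inj f g : H f -> H g -> coef_map f = coef_map g -> f = g.
Proof.
move=> Hf Hg fg; rewrite -(proj1 (ahm_holomorphic H_module Hf)).
rewrite -(proj1 (ahm_holomorphic H_module Hg)); apply: eq_ext0 => z Oz.
apply/colP => i; rewrite (ord1 i) (coef_map_decomposes Hf Oz) (coef_map_decomposes Hg Oz).
by rewrite fg.
Qed.

Lemma Gamma_spaceE : Gamma_space theta p Omega H = coef_map @` H.
Proof. by apply: eq_imagel => f Hf; exact: GammaE. Qed.

Lemma Gamma_ipE f g : H f -> H g ->
  Gamma_ip theta p Omega H ip (coef_map f) (coef_map g) = ip f g.
Proof.
move=> Hf Hg; rewrite /Gamma_ip; apply: xget_unique.
  by exists f, g; rewrite (GammaE Hf) (GammaE Hg).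
move=> c [f1 [g1 [Hf1 Hg1]]]; rewrite (GammaE Hf1) (GammaE Hg1).
by move=> /(coef_map_inj Hf Hf1) -> /(coef_map_inj Hg Hg1) -> ->.
Qed.

(** Both sides are continuous and are coefficients of the same function. *)
Lemma coef_map_pmul q f : H f -> pmul q (coef_map f) = coef_map (pmul (comp_mpoly theta q) f).
Proof.
move=> Hf; have Hqf := ahm_stable H_module (comp_mpoly theta q) Hf.
apply: continuous_coords_unique.
- by apply/funext => w; have [Dw|Dw] := pselect (D w);
    rewrite ?(ext0_in _ Dw)// (ext0_out _ Dw) /pmul /coef_map (ext0_out _ Dw) scaler0.
- exact: coef_map_ext0.
- move=> w Dw; have Fc := differentiable_continuous (coef_map_differentiable Hf Dw).
  exact: (cvgZ (@colval_continuous C n q w) Fc).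
- by move=> w Dw; apply: differentiable_continuous; exact: (coef_map_differentiable Hqf Dw).
move=> z Oz; rewrite -(coef_map_decomposes Hqf Oz).
transitivity (colval (comp_mpoly theta q) z * f z 0 0); last by rewrite [RHS]mxE.
rewrite (coef_map_decomposes Hf Oz) mulr_sumr colval_comp; apply: eq_bigr => k _.
by rewrite [X in _ * X]mxE mulrCA.
Qed.

Local Notation ipt := (Gamma_ip theta p Omega H ip).

Lemma coef_mapB f g : H f -> H g -> coef_map f - coef_map g = coef_map (f - g).
Proof.
move=> Hf Hg; have := coef_map_linear (-1) Hg Hf.
rewrite !scaleN1r => E; rewrite (addrC f) E; exact: addrC.
Qed.

Lemma hnorm_coef_map f : H f -> hnorm ipt (coef_map f) = nrm f.
Proof. by move=> Hf; rewrite /hnorm (Gamma_ipE Hf Hf). Qed.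

Lemma polymap_coef_map q : ext0 D (polymap (Q q)) = coef_map (polyfun q).
Proof.
apply: eq_ext0 => w Dw; apply/colP => k.
by rewrite [LHS]mxE [RHS]mxE -(coef_kernelP k Dw).2.
Qed.

Definition quotient_kernel z w : 'M[C]_d := \matrix_(j, k) coef_map (coef_kernel k w) z j 0.

Lemma quotient_kernel_reproducing :
  reproducing_kernel D (coef_map @` H) ipt quotient_kernel.
Proof.
move=> w Dw eta; have Hu k := (coef_kernelP k Dw).1.
pose kappa := \sum_k eta k 0 *: coef_kernel k w.
have Hkappa : H kappa := hilbert_lincomb hs (fun k => eta k 0) Hu.
have -> : ext0 D (fun z => quotient_kernel z w *m eta) = coef_map kappa.
  apply: eq_ext0 => z Dz; apply/colP => j; rewrite [LHS]mxE [RHS]mxE.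
  rewrite (ip_lincombl hs (fun k => eta k 0) Hu (coef_kernelP j Dz).1).
  by apply: eq_bigr => k _; rewrite mxE (coef_mapE _ _ Dz) mulrC.
split; first by exists kappa.
move=> _ [f Hf <-]; rewrite (Gamma_ipE Hf Hkappa).
rewrite (ip_lincomb hs (fun k => eta k 0) Hu Hf).
by apply: eq_bigr => k _; rewrite (coef_mapE _ _ Dw) mulrC.
Qed.

Lemma coef_map_module : analytic_hilbert_module D (coef_map @` H) ipt.
Proof.
split.
- exact: quotient_domain.
- by apply: (hilbert_transport hs); [exact: coef_map_linear|exact: Gamma_ipE].
- move=> _ [f Hf <-]; exact: (proj1 (coef_map_decomposition Hf)).
- by exists quotient_kernel; exact: quotient_kernel_reproducing.
- move=> q _ [f Hf <-]; rewrite (coef_map_pmul q Hf).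
  by exists (pmul (comp_mpoly theta q) f) => //; exact: (ahm_stable H_module).
- move=> q; have [M MP] := ahm_bounded H_module (comp_mpoly theta q).
  exists M => _ [f Hf <-]; rewrite (coef_map_pmul q Hf) (hnorm_coef_map Hf).
  rewrite (hnorm_coef_map (ahm_stable H_module _ Hf)); exact: MP.
- move=> q; pose q0 := \sum_(k < d) comp_mpoly theta (q k) * p k.
  exists (polyfun q0); first exact: polyfunH.
  rewrite -(polymap_coef_map q0); congr (ext0 _ (polymap _)); apply/funext => k.
  exact: (coords_unique theta_inv theta_ind theta_gen p_span p_free (erefl q0)).
- move=> _ [f Hf <-] e e0; have [q fq] := polyfun_dense Hf e0.
  exists (Q q); rewrite polymap_coef_map (coef_mapB Hf (polyfunH q)) hnorm_coef_map//.
  exact: (hilbertB hs Hf (polyfunH q)).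
Qed.

End CoefficientMap.

Theorem corollary6p4 (R : realType) (n : nat) (n_gt0 : (0 < n)%N)
    (gT : finGroupType) (G : {group gT})
    (rG : mx_representation (Cplx R) G n)
    (rG_faithful : mx_faithful rG)
    (G_generated : generated_by_pseudoreflections rG)
    (Omega : set 'cV[Cplx R]_n)
    (Omega_domain : domain Omega)
    (Omega_bounded : bounded_set Omega)
    (Omega_invariant : invariant_set rG Omega)
    (theta : n.-tuple (mpoly n (Cplx R)))
    (theta_hsop : hsop rG theta)
    (p : 'I_#|G| -> mpoly n (Cplx R))
    (p_basis : invariant_basis rG p)
    (H : set ('cV[Cplx R]_n -> 'cV[Cplx R]_1))
    (ip : ('cV[Cplx R]_n -> 'cV[Cplx R]_1) ->
          ('cV[Cplx R]_n -> 'cV[Cplx R]_1) -> Cplx R)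
    (H_module : analytic_hilbert_module Omega H ip)
    (K : 'cV[Cplx R]_n -> 'cV[Cplx R]_n -> 'M[Cplx R]_1)
    (K_kernel : reproducing_kernel Omega H ip K)
    (K_invariant : forall g z w, g \in G -> Omega z -> Omega w ->
       K (rG g *m z) (rG g *m w) = K z w) :
  let Ht := Gamma_space theta p Omega H in
  let ipt := Gamma_ip theta p Omega H ip in
  analytic_hilbert_module (theta_map theta @` Omega) Ht ipt /\
  exists2 U : ('cV[Cplx R]_n -> 'cV[Cplx R]_1) ->
              ('cV[Cplx R]_n -> 'cV[Cplx R]_#|G|),
    unitary H ip Ht ipt U &
    forall (q : mpoly n (Cplx R)) f, H f ->
      pmul q (U f) = U (pmul (comp_mpoly theta q) f).
Proof.
move=> Ht ipt.
have GE := GammaE rG_faithful Omega_domain Omega_invariant theta_hsop p_basis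
  H_module K_kernel K_invariant.
have HtE := Gamma_spaceE rG_faithful Omega_domain Omega_invariant theta_hsop
  p_basis H_module K_kernel K_invariant.
have hs := ahm_hilbert H_module.
split.
  rewrite /Ht HtE; exact: (coef_map_module rG_faithful Omega_domain Omega_invariant
    theta_hsop p_basis H_module K_kernel K_invariant).
exists (Gamma theta p Omega); last first.
  move=> q f Hf; rewrite (GE _ Hf) (GE _ (ahm_stable H_module _ Hf)).
  exact: (coef_map_pmul rG_faithful Omega_domain Omega_invariant theta_hsop p_basis
    H_module K_kernel K_invariant).
split=> [//|a f g Hf Hg|f g Hf Hg].
  rewrite (GE _ Hf) (GE _ Hg) (GE _ (hilbertP hs a Hf Hg)).
  exact: (coef_map_linear rG_faithful Omega_domain Omega_invariant theta_hsop p_basis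
    H_module K_kernel K_invariant).
rewrite (GE _ Hf) (GE _ Hg).
exact: (Gamma_ipE rG_faithful Omega_domain Omega_invariant theta_hsop p_basis
  H_module K_kernel K_invariant).
Qed.
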